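(* Let $n\ge2$, and suppose that $G\times\mathbf{Q}_n\to\mathbf{Q}_n$ is a uniform quasisimilarity action of a group $G$: there exists $K\ge1$ such that each element of $G$ acts by a $K$-quasisimilarity. Suppose in addition that the induced action of $G$ on the space of distinct pairs in $\mathbf{Q}_n$ is cocompact. Then there exist $m\ge2$ and a bilipschitz homeomorphism $\mathbf{Q}_n\to\mathbf{Q}_m$ which conjugates the $G$-action on $\mathbf{Q}_n$ to a similarity action on $\mathbf{Q}_m$.
   Context: For an integer $n\ge2$ (not necessarily prime), $\mathbf{Q}_n$ is the metric space of formal series $\xi=\sum_{i=k}^{+\infty}\xi_i n^i$ with $\xi_i\in\mathbf{Z}/n\mathbf{Z}$ and $k\in\mathbf{Z}$ (so $\xi$ is a sequence $(\xi_i)_{i\in\mathbf{Z}}$ with $\xi_i=0$ for all sufficiently negative $i$), with distance $d(\xi,\eta)=n^{-I}$ where $I$ is the greatest element of $\mathbf{Z}\cup\{+\infty\}$ such that $\xi_i=\eta_i$ for all $i\le I$. A similarity of a metric space $X$ is a bijection $f\colon X\to X$ such that $d(f\xi,f\eta)/d(\xi,\eta)$ is constant over all $\xi\ne\eta$. A $K$-quasisimilarity is a bijection $f\colon X\to X$ such that $$\frac{d(f\zeta,f\omega)}{d(\zeta,\omega)}\Bigm/\frac{d(f\xi,f\eta)}{d(\xi,\eta)}\le K\quad\text{for all }\zeta\ne\omega,\ \xi\ne\eta\in X.$$ A similarity action is one in which each group element acts by a similarity. A bijection $f\colon X\to Y$ of metric spaces is bilipschitz if there is $K\ge 1$ with $\frac1Kd(\xi,\eta)\le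 d(f\xi,f\eta)\le Kd(\xi,\eta)$ for all $\xi,\eta$. The space of distinct pairs in $\mathbf{Q}_n$ is $\{(\xi,\eta)\in\mathbf{Q}_n\times\mathbf{Q}_n:\xi\ne\eta\}$. *)

(* Defs.v *)
From HB Require Import structures.
From mathcomp Require Import all_boot all_order all_algebra.
From mathcomp Require Import lra zify.
From mathcomp Require Import all_classical all_reals all_analysis.

Set Implicit Arguments.
Unset Strict Implicit.
Unset Printing Implicit Defensive.

Import Order.TTheory GRing.Theory Num.Theory.

Local Open Scope classical_set_scope.
Local Open Scope ring_scope.

(* [R] is the field in which distances take their values; the points do not
   depend on it, it only allows the metric structure to be inferred from the
   type.  A digit of 'I_n is the residue in {0, ..., n-1} of a class of Z/nZ. *)
Record Qn (R : realType) (n : nat) := MkQn {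
  digit :> int -> 'I_n ;
  digit_ev0 : exists k : int, forall i, i < k -> digit i = 0 :> nat }.

HB.instance Definition _ (R : realType) (n : nat) := gen_eqMixin (Qn R n).
HB.instance Definition _ (R : realType) (n : nat) := gen_choiceMixin (Qn R n).

Section QnMetric.
Context {R : realType} {n : nat}.
Implicit Types x y z : Qn R n.

Definition agree_upto x y (I : int) : Prop := forall i, i <= I -> x i = y i.

Definition greatest_agree x y : set int :=
  [set I | agree_upto x y I /\ forall J, agree_upto x y J -> J <= I].

(* When x <> y the greatest I exists and is unique (greatest_agree_ex), so the
   default value 0 of xget is not used; x = y is the case I = +oo. *)
Definition Qn_dist x y : R :=
  if x == y then 0 else n%:R ^ (- xget 0 (greatest_agree x y)).

Lemma Qn_ext x y : digit x =1 digit y -> x = y.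
Proof.
case: x y => [x hx] [y hy] /= /funext e; rewrite -{y}e in hy *.
by congr MkQn; exact: Prop_irrelevance.
Qed.

Lemma greatest_agree_ex x y :
  x <> y -> greatest_agree x y (xget 0 (greatest_agree x y)).
Proof.
move=> xy; suff [I hI] : exists I, greatest_agree x y I by exact: (xgetI 0 hI).
have [k hk] : exists k : int, forall i, i < k -> x i = y i.
  have [[k1 h1] [k2 h2]] := (digit_ev0 x, digit_ev0 y).
  exists (Num.min k1 k2) => i; rewrite lt_min => /andP[i1 i2].
  by apply: val_inj; rewrite /= h1// h2.
have [j hj] : exists j, x j != y j.
  apply: contrapT => h; apply: xy; apply: Qn_ext => i.
  by apply: contrapT => /eqP hi; apply: h; exists i.
have kj : k <= j.
  by rewrite leNgt; apply: contra hj => /hk ->.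
have exm : exists m : nat, x (k + m%:Z) != y (k + m%:Z).
  by exists `|j - k|%N; rewrite (_ : k + _ = j) //; lia.
case: (ex_minnP exm) => m hm mmin.
exists (k + m%:Z - 1); split=> [i hi|J hJ].
  have [ik|ki] := ltP i k; first exact: hk.
  apply/eqP/negPn/negP => ne.
  have := mmin `|i - k|%N; rewrite (_ : k + _ = i); last lia.
  by move=> /(_ ne); lia.
rewrite leNgt; apply/negP => h; move/eqP: hm; apply.
by apply: hJ; lia.
Qed.

Lemma Qn_n_gt0 x : (0 < n)%N.
Proof. exact: leq_ltn_trans (leq0n _) (ltn_ord (x 0)). Qed.

Lemma Qn_dist_ge0 x y : 0 <= Qn_dist x y.
Proof. by rewrite /Qn_dist; case: ifP => // _; apply: exprz_ge0. Qed.

Lemma Qn_distxx x : Qn_dist x x = 0.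
Proof. by rewrite /Qn_dist eqxx. Qed.

Lemma Qn_dist_pos x y : Qn_dist x y = 0 -> x = y.
Proof.
rewrite /Qn_dist; case: eqP => // _ /eqP; rewrite expfz_eq0 => /andP[_].
by rewrite pnatr_eq0 => n0; have := Qn_n_gt0 x; rewrite lt0n n0.
Qed.

Lemma Qn_dist_sym x y : Qn_dist x y = Qn_dist y x.
Proof.
have agC a b J : agree_upto a b J -> agree_upto b a J by move=> h i /h.
rewrite /Qn_dist eq_sym; congr (if _ then _ else _ ^ (- xget _ _)).
by apply/seteqP; split=> I [h1 h2]; split=> [|J /agC /h2//]; exact: agC.
Qed.

Lemma Qn_dist_triangle y x z : Qn_dist x z <= Qn_dist x y + Qn_dist y z.
Proof.
have [->|xy] := eqVneq x y; first by rewrite Qn_distxx add0r.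
have [<-|yz] := eqVneq y z; first by rewrite Qn_distxx addr0.
have [->|xz] := eqVneq x z; first by rewrite Qn_distxx addr_ge0 ?Qn_dist_ge0.
move: (Qn_dist_ge0 x y) (Qn_dist_ge0 y z).
rewrite /Qn_dist (negbTE xy) (negbTE yz) (negbTE xz).
have [hxy _] := greatest_agree_ex (elimN eqP xy).
have [hyz _] := greatest_agree_ex (elimN eqP yz).
have [_ hxz] := greatest_agree_ex (elimN eqP xz).
move: (xget 0 _) (xget 0 _) (xget 0 _) hxy hyz hxz => c b a ha hb hc.
have n1 : 1 <= n%:R :> R by rewrite ler1n (Qn_n_gt0 x).
have mono I : I <= c -> n%:R ^ (- c) <= n%:R ^ (- I) :> R.
  by move=> Ic; apply: ler_weXz2l => //; rewrite lerN2.
have [ab|/ltW ba] := leP a b => a0 b0.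
- apply: (le_trans (mono a _)); last by rewrite lerDl.
  by apply: hc => i ia; rewrite ha// hb// (le_trans ia).
- apply: (le_trans (mono b _)); last by rewrite lerDr.
  by apply: hc => i ib; rewrite ha ?(le_trans ib)// hb.
Qed.

End QnMetric.

HB.instance Definition _ (R : realType) (n : nat) :=
  isMetric.Build R (Qn R n) (@Qn_distxx R n) (@Qn_dist_pos R n)
    (@Qn_dist_sym R n) (@Qn_dist_triangle R n).

Section MetricMaps.
Context {R : realType}.

Definition similarity (X : metricType R) (f : X -> X) : Prop :=
  bijective f /\
  exists c : R, forall x y, x <> y -> mdist (f x) (f y) / mdist x y = c.

Definition quasisimilarity (X : metricType R) (K : R) (f : X -> X) : Prop :=
  bijective f /\
  forall z w x y, z <> w -> x <> y ->
    (mdist (f z) (f w) / mdist z w) / (mdist (f x) (f y) / mdist x y) <= K.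

Definition bilipschitz (X Y : metricType R) (f : X -> Y) : Prop :=
  bijective f /\
  exists K : R, 1 <= K /\ forall x y,
    K^-1 * mdist x y <= mdist (f x) (f y) <= K * mdist x y.

End MetricMaps.

Definition group_action (G : groupType) (X : Type) (act : G -> X -> X) : Prop :=
  (forall x, act 1%g x = x) /\
  (forall g h x, act (g * h)%g x = act g (act h x)).

Definition similarity_action (R : realType) (G : groupType) (X : metricType R)
    (act : G -> X -> X) : Prop :=
  group_action act /\ forall g, similarity (act g).

Definition uniform_quasisimilarity_action (R : realType) (G : groupType)
    (X : metricType R) (act : G -> X -> X) : Prop :=
  group_action act /\
  exists K : R, 1 <= K /\ forall g, quasisimilarity K (act g).

Definition distinct_pairs (X : Type) : set (X * X) := [set p | p.1 <> p.2].
Arguments distinct_pairs X : clear implicits.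

Definition pair_action (G X : Type) (act : G -> X -> X) (g : G) (p : X * X) :
  X * X := (act g p.1, act g p.2).

(* Cocompactness of the action on the subspace D of T: D is covered by the
   translates of a compact subset.  Compactness of C in T is the same as its
   compactness in the subspace D. *)
Definition cocompact_on (G : Type) (T : topologicalType) (D : set T)
    (act : G -> T -> T) : Prop :=
  exists C : set T, [/\ compact C, C `<=` D &
    D `<=` \bigcup_(g in [set: G]) (act g @` C)].

Definition conjugates (G X Y : Type) (f : X -> Y)
    (actX : G -> X -> X) (actY : G -> Y -> Y) : Prop :=
  forall g x, f (actX g x) = actY g (f x).

(* Main.v *)
Require Import Defs.
From HB Require Import structures.
From mathcomp Require Import all_boot all_order all_algebra.
From mathcomp Require Import zify lra ring finmap.
From mathcomp Require Import all_classical all_reals all_analysis.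

(* A [K]-quasisimilarity [g] moves all levels of agreement by [l g] up to a
   bounded error.  The translates [gB] of a ball [B] are unions of balls of
   comparable size, so setwise stabilizers of such sets have finite orbits on
   such sets, and [|S_A.A'| / |S_A'.A|] ([S_A] the stabilizer of [A]) is a
   [G]-invariant cocycle.  Hence [Delta g = |S_gB.B| / |S_B.gB|] is a genuine
   homomorphism (the modular function of the closure of [G]).  By cocompactness
   the stabilizer of a ball moves small balls inside it almost transitively, so
   [Delta g] is the stretch factor of [g] up to a bounded factor.  Then
   [sup_h d(hx, hy) / Delta h] is an ultrametric bilipschitz to [d] which [G]
   rescales exactly.  The [G]-translates of one of its balls form a tree on
   which [G] is transitive, hence a regular one, say with [m] children at each
   vertex; counting orbits, [Delta] of a one-step translation is [m].  Labelling
   the children of each vertex by digits identifies the space with [Q_m]. *)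

Set Implicit Arguments.
Unset Strict Implicit.
Unset Printing Implicit Defensive.

Import Order.TTheory GRing.Theory Num.Theory.

Local Open Scope classical_set_scope.
Local Open Scope ring_scope.

(** * Levels of agreement *)

Section Agreement.
Context {R : realType} {n : nat}.
Implicit Types (x y z : Qn R n) (i j : int) (U : set (Qn R n)).

Lemma agree_refl x i : agree_upto x x i.
Proof. by []. Qed.

Lemma agree_sym x y i : agree_upto x y i -> agree_upto y x i.
Proof. by move=> h j /h. Qed.

Lemma agree_trans y x z i :
  agree_upto x y i -> agree_upto y z i -> agree_upto x z i.
Proof. by move=> h1 h2 j ji; rewrite h1// h2. Qed.

Lemma agree_le x y i j : j <= i -> agree_upto x y i -> agree_upto x y j.
Proof. by move=> ji h l lj; apply: h; exact: le_trans ji. Qed.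

Lemma agree_eq x y : (forall i, agree_upto x y i) -> x = y.
Proof. by move=> h; apply: Qn_ext => i; exact: (h i). Qed.

Lemma agree_ex x y : exists i, agree_upto x y i.
Proof.
have [->|/eqP xy] := eqVneq x y; first by exists 0.
by have [h _] := greatest_agree_ex xy; eexists; exact: h.
Qed.

Lemma agree_level x y : x <> y ->
  exists l, forall i, agree_upto x y i <-> i <= l.
Proof.
move=> xy; have [h1 h2] := greatest_agree_ex xy.
by exists (xget 0 (greatest_agree x y)) => i; split=> [/h2//|/agree_le]; exact.
Qed.

Lemma mdist_level x y l : x <> y -> (forall i, agree_upto x y i <-> i <= l) ->
  mdist x y = n%:R ^ (- l) :> R.
Proof.
move=> xy hl; rewrite /mdist /= /Qn_dist; case: eqP => // _.
have [h1 h2] := greatest_agree_ex xy; congr (_ ^ (- _)).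
by apply: le_anti; rewrite (proj1 (hl _) h1) h2//; apply/hl.
Qed.

Lemma mdist_agree x y i : (1 < n)%N ->
  mdist x y <= n%:R ^ (- i) :> R <-> agree_upto x y i.
Proof.
move=> n1; have [->|/eqP xy] := eqVneq x y.
  by rewrite mdistxx; split=> // _; rewrite exprz_ge0.
have [l hl] := agree_level xy; rewrite (mdist_level xy hl) hl.
by rewrite ler_eXz2l ?ltr1n// lerN2.
Qed.

Definition cell x i : set (Qn R n) := [set y | agree_upto x y i].

(** Unions of cells of level [i]: a uniform form of openness. *)
Definition saturated i U := forall x y, U x -> agree_upto x y i -> U y.

Lemma saturated_le i j U : i <= j -> saturated i U -> saturated j U.
Proof. by move=> ij h x y Ux xy; apply: (h x) => //; exact: agree_le xy. Qed.

(** * Finite nets in a cell *)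

Section Net.
Variables (x : Qn R n) (i : int) (p : nat).
Implicit Types v w : {ffun 'I_p -> 'I_n}.

(** Digits [i + 1] to [i + p] come from [v], all others (also those beyond [i + p]) from [x]. The
    net thus has exactly one point in each cell of level [i + p] inside [cell x i]. *)
Let netd v j :=
  if i < j then oapp v (x j) (insub (absz (j - i - 1)%R))
  else x j.

Let net_ev0 v : exists k : int, forall j, j < k -> netd v j = 0 :> nat.
Proof.
have [k hk] := digit_ev0 x; exists (Num.min k i) => j.
by rewrite lt_min /netd => /andP[jk ji]; rewrite ltNge (ltW ji) /= hk.
Qed.

Definition net v : Qn R n := MkQn R (net_ev0 v).

Lemma net_agree v : agree_upto x (net v) i.
Proof. by move=> j ji /=; rewrite /netd ltNge ji. Qed.

Lemma netE v (t : 'I_p) : net v (i + 1 + t%:Z) = v t.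
Proof.
rewrite /= /netd ifT; last by lia.
have -> : absz (i + 1 + t%:Z - i - 1)%R = t by lia.
by rewrite valK.
Qed.

Lemma net_inj v w : agree_upto (net v) (net w) (i + p%:Z) -> v = w.
Proof.
move=> h; apply/ffunP => t; rewrite -!netE; apply: h.
by have := ltn_ord t; lia.
Qed.

Lemma net_cover y : agree_upto x y i ->
  exists v, agree_upto y (net v) (i + p%:Z).
Proof.
move=> xy; exists [ffun t : 'I_p => y (i + 1 + t%:Z)] => j jip.
rewrite /= /netd; have [ij|ji] := ltP i j; last by rewrite xy.
have tp : (absz (j - i - 1)%R < p)%N by lia.
by rewrite insubT /= ffunE /=; congr (digit y); lia.
Qed.

Definition net_code U : {set {ffun 'I_p -> 'I_n}} :=
  [set v | `[< U (net v) >]]%SET.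

(** Both sets are unions of cells of level [i + p], and each such cell contains a net point. *)
Lemma net_code_inj U V : U `<=` cell x i -> V `<=` cell x i ->
  saturated (i + p%:Z) U -> saturated (i + p%:Z) V ->
  net_code U = net_code V -> U = V.
Proof.
move=> Ux Vx Us Vs /setP UV.
have e v : U (net v) <-> V (net v).
  have := UV v; rewrite !inE => e.
  by split=> h; apply/asboolP; [rewrite -e|rewrite e]; exact/asboolP.
by apply/seteqP; split=> y h;
   [have /net_cover[v yv] := Ux y h|have /net_cover[v yv] := Vx y h];
   [apply: (Vs (net v)); last exact: agree_sym; apply/e; exact: Us yv|
    apply: (Us (net v)); last exact: agree_sym; apply/e; exact: Vs yv].
Qed.

End Net.

(** With at least two digits available, digit [i + 1] of [x] can be changed. Pairs of prescribed
    level made this way are the test pairs for levels of group elements. *)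
Lemma agree_exactly x i : (1 < n)%N ->
  exists w, forall j, agree_upto x w j <-> j <= i.
Proof.
move=> n1; have n0 : (0 < n)%N by lia.
have [d hd] : exists d : 'I_n, d != x (i + 1).
  have [e|e] := eqVneq (Ordinal n0) (x (i + 1)); last by exists (Ordinal n0).
  by exists (Ordinal n1); rewrite -e.
exists (net x i [ffun _ : 'I_1 => d]) => j; split=> [h|ji]; last first.
  by apply: agree_le ji _; exact: net_agree.
rewrite leNgt; apply/negP => ij; move/eqP: hd; apply.
have /= e := netE x i [ffun _ : 'I_1 => d] ord0; rewrite ffunE addr0 in e.
by rewrite -e; apply/esym/h; lia.
Qed.

End Agreement.

(** * Orbits and the modular cocycle *)

Section Ncard.
Implicit Types T U : choiceType.

(* 0 when S is infinite. *)
Definition ncard T (S : set T) : nat := #|` fset_set S|.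

Lemma finite_inj (T U : Type) (f : T -> U) (S : set T) (V : set U) :
  finite_set V -> {in S &, injective f} -> {homo f : x / S x >-> V x} ->
  finite_set S.
Proof.
move=> finV finj fSV; rewrite -(eq_finite_set (inj_card_eq finj)).
by apply: sub_finite_set finV => _ [x Sx <-]; exact: fSV.
Qed.

Lemma ncard_image T U (f : T -> U) (S : set T) : finite_set S ->
  {in S &, injective f} -> ncard (f @` S) = ncard S.
Proof.
move=> finS finj; apply/fcard_eq => //; first exact: finite_image.
exact: inj_card_eq.
Qed.

Lemma leq_ncard T (S S' : set T) : finite_set S' -> S `<=` S' ->
  (ncard S <= ncard S')%N.
Proof.
move=> finS' SS'; apply: fsubset_leq_card.
by rewrite -fset_set_sub//; exact: sub_finite_set finS'.
Qed.

Lemma ncard_inj T U (f : T -> U) (S : set T) (V : set U) :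
  finite_set V -> {in S &, injective f} -> {homo f : x / S x >-> V x} ->
  (ncard S <= ncard V)%N.
Proof.
move=> finV finj fSV; rewrite -(ncard_image (finite_inj finV finj fSV) finj).
by apply: leq_ncard => // _ [x Sx <-]; exact: fSV.
Qed.

Lemma ncard_bij T U (f : T -> U) (S : set T) (V : set U) :
  finite_set S -> {in S &, injective f} -> f @` S = V -> ncard V = ncard S.
Proof. by move=> finS finj <-; exact: ncard_image. Qed.

Lemma ncardT (T : finType) : ncard [set: T] = #|T|.
Proof.
rewrite /ncard -card_finset; congr (#|` _|); apply/fsetP => x.
rewrite in_fset_set; last exact: finite_finset.
by rewrite in_fset; apply: mem_set.
Qed.

Lemma ncardX T U (S : set T) (V : set U) : finite_set S -> finite_set V ->
  ncard (S `*` V) = (ncard S * ncard V)%N.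
Proof.
move=> finS finV; rewrite {2 3}/ncard !cardfE -card_prod -ncardT.
apply: (ncard_bij (f := fun p => (val p.1, val p.2))).
- exact: finite_finset.
- by move=> [? ?] [? ?] _ _ /= [/val_inj -> /val_inj ->].
apply/seteqP; split=> [_ [[[s hs] [v hv]] _ <-]|[s v] [/= Ss Vv]].
  by split=> /=; apply: set_mem; rewrite -in_fset_set.
have hs : s \in fset_set S by rewrite in_fset_set// inE.
have hv : v \in fset_set V by rewrite in_fset_set// inE.
by exists ([` hs], [` hv])%fset.
Qed.

Lemma ncard_gt0 T (S : set T) x : finite_set S -> S x -> (0 < ncard S)%N.
Proof.
move=> finS Sx; rewrite cardfs_gt0; apply/fset0Pn; exists x.
by rewrite in_fset_set// inE.
Qed.

Lemma ncard1 T (x : T) : ncard [set x] = 1.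
Proof. by rewrite /ncard fset_set1 cardfs1. Qed.

End Ncard.

Section Action.
Context {G : groupType} {T : Type} {act : G -> T -> T}.
Hypothesis actP : group_action act.

Lemma act1 x : act 1%g x = x.
Proof. exact: actP.1. Qed.

Lemma actM g h x : act (g * h)%g x = act g (act h x).
Proof. exact: actP.2. Qed.

Lemma actK g : cancel (act g) (act g^-1%g).
Proof. by move=> x; rewrite -actM mulVg act1. Qed.

Lemma actVK g : cancel (act g^-1%g) (act g).
Proof. by move=> x; rewrite -actM mulgV act1. Qed.

Lemma act_inj g : injective (act g).
Proof. exact: can_inj (actK g). Qed.

Definition set_act (g : G) (A : set T) : set T := act g @` A.

Lemma set_actP : group_action set_act.
Proof.
split=> [A|g h A]; rewrite /set_act.
  by rewrite -[RHS]image_id; apply: eq_imagel => x _; rewrite act1.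
by rewrite image_comp; apply: eq_imagel => x _; rewrite actM.
Qed.

Lemma mem_set_act g A x : set_act g A (act g x) <-> A x.
Proof. by split=> [[y Ay /act_inj <-]|Ax] //; exists x. Qed.

Lemma mem_set_actV g A x : set_act g A x <-> A (act g^-1%g x).
Proof. by rewrite -{1}[x](actVK g) mem_set_act. Qed.

End Action.
Arguments set_act {G T} act g A _.

(** * Orbit counting and the modular cocycle of an abstract action *)

Section Orbits.
Context {G : groupType} {T : choiceType} {act : G -> T -> T}.
Hypothesis actP : group_action act.
Implicit Types (a b c : T) (H : set G).

Definition stab a : set G := [set g | act g a = a].

Definition orb H b : set T := [set act h b | h in H].

Definition subgroup H := [/\ H 1%g, forall g h, H g -> H h -> H (g * h)%g &
  forall g, H g -> H g^-1%g].

Lemma stab_subgroup a : subgroup (stab a).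
Proof.
split=> [|g h /= ga ha|g /= ga]; first exact: act1.
  by rewrite /stab/= (actM actP) ha.
by rewrite /stab/= -{1}ga (actK actP).
Qed.

(** The orbit of the pair projects onto the orbit of [b]. Elements [r b'] of [H] taking [b] to [b']
    identify the fibre over [b'] with the one over [b], which is the orbit of [c] under [H]
    intersected with [stab b]. *)
Lemma ncard_orb_pair H b c : subgroup H ->
    finite_set (orb H b) -> finite_set (orb H c) ->
  ncard [set (act h b, act h c) | h in H] =
  (ncard (orb H b) * ncard (orb (H `&` stab b) c))%N.
Proof.
move=> [H1 HM HV] finb finc.
have /choice[r hr] : forall b', exists g, orb H b b' -> H g /\ act g b = b'.
  move=> b'; have [[h Hh e]|nb] := pselect (orb H b b'); first by exists h.
  by exists 1%g.
have finc' : finite_set (orb (H `&` stab b) c).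
  by apply: sub_finite_set finc => _ [h [Hh _] <-]; exists h.
rewrite -ncardX//.
pose f (p : T * T) := (p.1, act (r p.1) p.2).
apply: (@ncard_bij _ _ f).
- exact: finite_setX.
- by move=> [b1 c1] [b2 c2] _ _ /= [<- /(act_inj actP) <-].
apply/seteqP; split=> [_ [[b0 c0] [/= hb [k [Hk kb] <-]] <-]|_ [h Hh <-]].
  have [Hr er] := hr _ hb; exists (r b0 * k)%g; first exact: HM.
  by rewrite !(actM actP) kb er.
have hb : orb H b (act h b) by exists h.
have [Hr er] := hr _ hb.
exists (act h b, act ((r (act h b))^-1 * h)%g c) => /=; last first.
  by rewrite /f/= (actM actP) (actVK actP).
split=> //; exists ((r (act h b))^-1 * h)%g => //; split.
  by apply: HM => //; exact: HV.
by rewrite /stab/= (actM actP) -{2}er (actK actP).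
Qed.

(** The orbit of the pair [(b, c)] is counted from either coordinate. *)
Lemma ncard_orbC H b c : subgroup H ->
    finite_set (orb H b) -> finite_set (orb H c) ->
  (ncard (orb H b) * ncard (orb (H `&` stab b) c) =
   ncard (orb H c) * ncard (orb (H `&` stab c) b))%N.
Proof.
move=> subH finb finc; rewrite -!ncard_orb_pair//.
pose f (p : T * T) := (p.2, p.1); apply: (@ncard_bij _ _ f).
- apply: sub_finite_set (finite_setX finc finb) => _ [h Hh <-].
  by split; exists h.
- by move=> [? ?] [? ?] _ _ /= [-> ->].
by rewrite image_comp.
Qed.

Definition commensurable a b :=
  finite_set (orb (stab a) b) /\ finite_set (orb (stab b) a).

Lemma orb_stab_gt0 a b : finite_set (orb (stab a) b) ->
  (0 < ncard (orb (stab a) b))%N.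
Proof.
move=> fin; apply: (@ncard_gt0 _ _ b) => //; exists 1%g; rewrite ?act1//.
by have [] := stab_subgroup a.
Qed.

Lemma ncard_orb_act g a b :
  finite_set (orb (stab a) b) ->
  ncard (orb (stab (act g a)) (act g b)) = ncard (orb (stab a) b).
Proof.
move=> fin; apply: (@ncard_bij _ _ (act g)) => //.
  by move=> x y _ _; exact: act_inj.
apply/seteqP; split=> [_ [_ [h ha <-] <-]|_ [h ha <-]].
  exists (g * h * g^-1)%g; last by rewrite !(actM actP) (actK actP).
  by rewrite /stab/= !(actM actP) (actK actP) ha.
exists (act (g^-1 * h * g)%g b); last by rewrite !(actM actP) (actVK actP).
by exists (g^-1 * h * g)%g => //; rewrite /stab/= !(actM actP) ha (actK actP).
Qed.

Context {R : realType}.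

(** By orbit-stabilizer this is [S_a : S_a ∩ S_b] / [S_b : S_a ∩ S_b] for commensurable [a] and [b]:
    formally the ratio of the Haar measures of the two stabilizers. *)
Definition modular a b : R :=
  (ncard (orb (stab a) b))%:R / (ncard (orb (stab b) a))%:R.

Lemma modular_gt0 a b : commensurable a b -> 0 < modular a b.
Proof.
by move=> [fa fb]; rewrite divr_gt0// ltr0n; exact: orb_stab_gt0.
Qed.

Lemma modular_act g a b : commensurable a b ->
  modular (act g a) (act g b) = modular a b.
Proof. by move=> [fa fb]; rewrite /modular !ncard_orb_act. Qed.

(* The three exchanges of [ncard_orbC] multiply to the cocycle identity. *)
Lemma modular_cocycle a b c : commensurable a b -> commensurable b c ->
  commensurable a c -> modular a b * modular b c = modular a c.
Proof.
move=> [ab ba] [bc cb] [ac ca]; rewrite /modular.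
have pos x y : finite_set (orb (stab x) y) ->
    (ncard (orb (stab x) y))%:R != 0 :> R.
  by move=> fin; rewrite pnatr_eq0 -lt0n orb_stab_gt0.
have pos2 x y z : finite_set (orb (stab x) z) ->
    (ncard (orb (stab x `&` stab y) z))%:R != 0 :> R.
  move=> fin; rewrite pnatr_eq0 -lt0n; apply: (@ncard_gt0 _ _ z).
    by apply: sub_finite_set fin => _ [h [ha _] <-]; exists h.
  by exists 1%g; rewrite ?act1//; split; exact: act1.
have key x y z : finite_set (orb (stab x) y) -> finite_set (orb (stab x) z) ->
    (ncard (orb (stab x) y))%:R * (ncard (orb (stab x `&` stab y) z))%:R =
    (ncard (orb (stab x) z))%:R * (ncard (orb (stab x `&` stab z) y))%:R :> R.
  by move=> fy fz; rewrite -!natrM ncard_orbC//; exact: stab_subgroup.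
have := key a b c ab ac; have := key b c a bc ba; have := key c a b ca cb.
rewrite (setIC (stab c) (stab a)) (setIC (stab c) (stab b)).
rewrite (setIC (stab b) (stab a)).
move: (pos _ _ ab) (pos _ _ ba) (pos _ _ bc) (pos _ _ cb) (pos _ _ ac)
  (pos _ _ ca) (pos2 a b c ac) (pos2 b c a ba) (pos2 a c b ab).
set xab := (ncard (orb (stab a) b))%:R.
set xba := (ncard (orb (stab b) a))%:R.
set xbc := (ncard (orb (stab b) c))%:R.
set xcb := (ncard (orb (stab c) b))%:R.
set xac := (ncard (orb (stab a) c))%:R.
set xca := (ncard (orb (stab c) a))%:R.
move: (_%:R) (_%:R) (_%:R) => w v u ab0 ba0 bc0 cb0 ac0 ca0 u0 v0 w0 e1 e2 e3.
rewrite mulf_div; apply/eqP; rewrite eqr_div ?mulf_neq0//; apply/eqP.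
apply: (mulIf (mulf_neq0 (mulf_neq0 u0 v0) w0)).
transitivity ((xab * u) * (xbc * v) * (xca * w)); first by ring.
by rewrite e1 e2 e3; ring.
Qed.

End Orbits.
Arguments stab {G T} act a _.
Arguments orb {G T} act H b _.
Arguments commensurable {G T} act a b.
Arguments modular {G T} act {R} a b.

(** * Actions that shift levels coarsely *)

(** Uniform quasisimilarity on a logarithmic scale: [g] multiplies distances by n^(- l g) up to a
    factor n^k, with [k] independent of [g]. *)
Definition quasilevel (R : realType) (n : nat) (G : Type)
    (act : G -> Qn R n -> Qn R n) (l : G -> int) (k : nat) : Prop :=
  forall g x y i,
    (agree_upto x y i -> agree_upto (act g x) (act g y) (i + l g - k%:Z)) /\
    (agree_upto (act g x) (act g y) i -> agree_upto x y (i - l g - k%:Z)).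

Section Quasilevel.
Context {R : realType} {n : nat} {G : groupType}.
Context {act : G -> Qn R n -> Qn R n} {l : G -> int} {k : nat}.
Hypotheses (n1 : (1 < n)%N) (actP : group_action act).
Hypothesis (lP : quasilevel act l k).
Implicit Types (x y z : Qn R n) (i j : int) (U V : set (Qn R n)) (g h s : G).

Notation sact := (set_act act).

Lemma quasi_fwd g x y i j : agree_upto x y i -> j <= i + l g - k%:Z ->
  agree_upto (act g x) (act g y) j.
Proof. by move=> xy ji; apply: agree_le ji _; have [+ _] := lP g x y i; exact.
Qed.

Lemma quasi_bwd g x y i j : agree_upto (act g x) (act g y) i ->
  j <= i - l g - k%:Z -> agree_upto x y j.
Proof. by move=> xy ji; apply: agree_le ji _; have [_ +] := lP g x y i; exact.
Qed.

(** A pair of exact level 0 is followed along [g * h] and along [h] then [g]; each of the three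
    applications costs an error [k]. *)
Lemma level_mul x g h : `|l (g * h)%g - l g - l h| <= 3 * k%:Z.
Proof.
have [w hw] := agree_exactly x 0 n1; have /hw xw0 : 0 <= 0 :> int by [].
have /hw h1 : agree_upto x w (l g + l h - l (g * h)%g - 3 * k%:Z).
  apply: (@quasi_bwd (g * h)%g _ _ (l h - k%:Z + l g - k%:Z)); last by lia.
  rewrite !(actM actP); apply: (@quasi_fwd g _ _ (l h - k%:Z)) => //.
  by apply: quasi_fwd xw0 _; lia.
have /hw h2 : agree_upto x w (l (g * h)%g - l g - l h - 3 * k%:Z).
  apply: (@quasi_bwd h _ _ (l (g * h)%g - k%:Z - l g - k%:Z)); last by lia.
  apply: (@quasi_bwd g _ _ (l (g * h)%g - k%:Z)) => //.
  by rewrite -!(actM actP); apply: quasi_fwd xw0 _; lia.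
lia.
Qed.

Lemma level1 x : `|l 1%g| <= k%:Z.
Proof.
have [w hw] := agree_exactly x 0 n1; have /hw xw0 : 0 <= 0 :> int by [].
have /hw h1 : agree_upto x w (l 1%g - k%:Z).
  by rewrite -[x](act1 actP) -[w](act1 actP); apply: quasi_fwd xw0 _; lia.
have /hw h2 : agree_upto x w (- l 1%g - k%:Z).
  by apply: (@quasi_bwd 1%g _ _ 0); rewrite ?(act1 actP)//; lia.
lia.
Qed.

Lemma level_inv x g : `|l g + l g^-1%g| <= 4 * k%:Z.
Proof. by have := level_mul x g g^-1%g; have := level1 x; rewrite mulgV; lia.
Qed.

Lemma set_act_sub g U x i j : U `<=` cell x i -> j <= i + l g - k%:Z ->
  sact g U `<=` cell (act g x) j.
Proof. by move=> Ux ji _ [y Uy <-]; apply: quasi_fwd ji; exact: Ux. Qed.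

Lemma set_act_saturated g U i j : saturated i U -> i + l g + k%:Z <= j ->
  saturated j (sact g U).
Proof.
move=> Us ij x y /(mem_set_actV actP) Ux xy; apply/(mem_set_actV actP).
apply: Us Ux _; apply: (@quasi_bwd g _ _ j); last by lia.
by rewrite !(actVK actP).
Qed.

(** Nonempty, bounded and uniformly open: these are the nonempty compact open subsets. *)
Definition good U := [/\ U !=set0, exists i, forall x, U x -> U `<=` cell x i
  & exists i, saturated i U].

Lemma good_set_act g U : good U -> good (sact g U).
Proof.
move=> [[x Ux] [i Ui] [j Uj]]; split; first by exists (act g x), x.
  exists (i + l g - k%:Z) => _ [y Uy <-].
  by apply: (@set_act_sub _ _ _ i) => //; exact: Ui.
by exists (j + l g + k%:Z); apply: set_act_saturated Uj _.
Qed.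

(** By saturation [U] contains a pair of exact level [j]. Both [s] and its inverse map this pair
    into [U], where any two points agree up to [i], so neither can lower its level much below
    [i]. *)
Lemma stab_level U x i j s : U x -> (forall x, U x -> U `<=` cell x i) ->
  saturated j U -> stab sact U s -> `|l s| <= j - i + k%:Z.
Proof.
move=> Ux Ui Uj sU; have [w hw] := agree_exactly x j n1.
have Uw : U w by apply: Uj Ux _; apply/hw.
have U1 u : U u -> U (act s u) by rewrite -{2}sU; exists u.
have U2 u : U u -> U (act s^-1%g u).
  by move=> Uu; apply/(mem_set_actV actP); rewrite sU.
have /hw h1 : agree_upto x w (i - l s - k%:Z).
  by apply: (@quasi_bwd s _ _ i) => //; exact: (Ui _ (U1 _ Ux) _ (U1 _ Uw)).
have /hw h2 : agree_upto x w (i + l s - k%:Z).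
  rewrite -[x](actVK actP s) -[w](actVK actP s).
  by apply: (@quasi_fwd s _ _ i) => //; exact: (Ui _ (U2 _ Ux) _ (U2 _ Uw)).
lia.
Qed.

(** Sets confined between two scales. Their codes bound their number by [nfits p], whatever [x] and
    [i] are; the constants in the orbit counts below rest on this uniformity. *)
Definition fits x i p : set (set (Qn R n)) :=
  [set U | U `<=` cell x i /\ saturated (i + p%:Z) U].

Lemma fits_code_inj x i p : {in fits x i p &, injective (@net_code R n x i p)}.
Proof. by move=> U V /set_mem[? ?] /set_mem[? ?]; exact: net_code_inj. Qed.

Lemma finite_fits x i p : finite_set (fits x i p).
Proof.
by apply: (finite_inj (V := setT) _ (@fits_code_inj x i p)) => //;
  exact: finite_finset.
Qed.

Definition nfits p : nat := #|{set {ffun 'I_p -> 'I_n}}|.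

Lemma ncard_fits x i p S : S `<=` fits x i p ->
  (ncard S <= nfits p)%N.
Proof.
move=> Sx; apply: leq_trans (leq_ncard (finite_fits x i p) Sx) _.
rewrite /nfits -ncardT.
by apply: (ncard_inj (V := setT) _ (@fits_code_inj x i p)) => //;
  exact: finite_finset.
Qed.

(** Elements stabilizing [U] have bounded level, so they move [V] to sets of controlled position and
    size, of which there are finitely many. *)
Lemma good_commensurable U V : good U -> good V ->
  commensurable sact U V.
Proof.
suff {U V} key U V : good U -> good V -> finite_set (orb sact (stab sact U) V).
  by move=> gU gV; split; exact: key.
move=> [[x Ux] [a Ua] [b Ub]] [[y Vy] [a' Va] [b' Vb]].
have [j xy] := agree_ex x y.
(* [V] lies in [cell x m], [c] bounds the levels of the stabilizer of [U], and all translates of [V]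
   by it stay in [cell x e]. *)
pose m := Num.min j a'; pose c := b - a + k%:Z.
pose e := Num.min a (m - c - k%:Z).
apply: (sub_finite_set _ (finite_fits x e (absz (b' + c + k%:Z - e)%R))).
move=> _ [s sU <-]; have := stab_level Ux Ua Ub sU; rewrite -/c => sc; split.
  have xsx : agree_upto x (act s x) a.
    by apply: (Ua x Ux); rewrite -[U in U _]sU; exists x.
  apply: (@subset_trans _ (cell (act s x) e)).
    apply: (@set_act_sub _ _ _ m); last by rewrite /e; lia.
    move=> z Vz; apply: (agree_trans (y := y)).
      by apply: agree_le xy; rewrite /m; lia.
    by apply: agree_le (Va _ Vy _ Vz); rewrite /m; lia.
  move=> z; apply: agree_trans; apply: agree_le xsx; rewrite /e; lia.
by apply: set_act_saturated Vb _; lia.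
Qed.

End Quasilevel.

(** * The modular cocycle measures scale *)

Section Modular.
Context {R : realType} {n : nat} {G : groupType}.
Context {act : G -> Qn R n -> Qn R n} {l : G -> int} {k : nat}.
Context {x0 : Qn R n} {i0 : int}.
Hypotheses (n1 : (1 < n)%N) (actP : group_action act).
Hypothesis (lP : quasilevel act l k).
Hypothesis cov : forall z i,
  exists g, set_act act g (cell x0 i0) z /\ `|l g - i| <= k%:Z.
Implicit Types (x y z : Qn R n) (i j : int) (U V : set (Qn R n)) (g h s : G).

Notation sact := (set_act act).
Notation A0 := (cell x0 i0).
Let level_mul g h := level_mul n1 actP lP x0 g h.
Let level1 := level1 n1 actP lP x0.
Let level_inv g := level_inv n1 actP lP x0 g.

Lemma cell_sub x y i : cell x i y -> cell x i `<=` cell y i.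
Proof. by move=> xy z xz; apply: agree_trans xz; exact: agree_sym. Qed.

Lemma good_cell x i : good (cell x i).
Proof.
split; first by exists x; exact: agree_refl.
  by exists i => y; exact: cell_sub.
by exists i => y z xy; exact: agree_trans.
Qed.

Lemma translate_mem g : sact g A0 (act g x0).
Proof. by exists x0 => //; exact: agree_refl. Qed.

Lemma translate_sub g x :
  sact g A0 x -> sact g A0 `<=` cell x (i0 + l g - k%:Z).
Proof.
move=> [y yA <-]; apply: (@set_act_sub _ _ _ _ _ _ lP _ _ _ i0) => //.
exact: cell_sub.
Qed.

Lemma translate_saturated g : saturated (i0 + l g + k%:Z) (sact g A0).
Proof.
apply: (@set_act_saturated _ _ _ _ _ _ n1 actP lP _ _ i0) => // y z xy.
exact: agree_trans.
Qed.

Lemma translate_fits g x i p : sact g A0 x -> i <= i0 + l g - k%:Z ->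
  i0 + l g + k%:Z <= i + p%:Z -> fits x i p (sact g A0).
Proof.
move=> gx ig gp; split; last exact: saturated_le (@translate_saturated g).
by move=> y /(translate_sub gx); exact: agree_le.
Qed.

Lemma stab_translate_level g s : stab sact (sact g A0) s -> `|l s| <= 3 * k%:Z.
Proof.
have Ui := translate_sub (g := g); have Us := @translate_saturated g.
by move=> /(stab_level n1 actP lP (translate_mem g) Ui Us); lia.
Qed.

Lemma stab_translate_mul g s h : stab sact (sact g A0) s ->
  `|l (s * h)%g - l h| <= 6 * k%:Z.
Proof. by move=> /stab_translate_level; have := level_mul s h; lia. Qed.

Lemma sactM g h U : sact (g * h)%g U = sact g (sact h U).
Proof. exact: (set_actP actP).2. Qed.

Lemma good_translate g : good (sact g A0).
Proof. by apply: (good_set_act n1 actP lP); exact: good_cell. Qed.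

Lemma commensurable_translate g h : commensurable sact (sact g A0) (sact h A0).
Proof. by apply: (good_commensurable n1 actP lP); exact: good_translate. Qed.

(** * Orbit counts for one translate inside another *)

Section Nested.
Variables g h : G.
Notation D := (sact g A0).
Notation A := (sact h A0).
Hypothesis AD : A `<=` D.

(** Each translate of [A] by the stabilizer of [D] contains one of n^q net points of a cell around
    [D], and is then one of [nfits (14 * k)] sets near that point. *)
Lemma ncard_orb_small : l g <= l h ->
  (ncard (orb sact (stab sact D) A) <=
   n ^ absz (l h - l g + 8 * k%:Z)%R * @nfits n (14 * k))%N.
Proof.
(* The net has level [a + q = i0 + l h + 7k], at which every translate [s A] is saturated, since
   [l (s * h)] is within [6k] of [l h]. *)
move=> gh; set q := absz _; pose a := i0 + l g - k%:Z.
have hnet B : exists v : {ffun 'I_q -> 'I_n}, orb sact (stab sact D) A B ->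
    fits (net (act g x0) a v) (a + q%:Z - 14 * k%:Z) (14 * k) B.
  have [[s sD <-]|no] := pselect (orb sact (stab sact D) A B); last first.
    by exists [ffun=> Ordinal (ltnW n1)].
  rewrite -sactM; have sh := stab_translate_mul h sD.
  have Dsh : D (act (s * h)%g x0).
    rewrite -[D]sD (actM actP); exists (act h x0) => //.
    by apply: AD; exact: translate_mem.
  have /(@net_cover _ _ _ a q)[v hv] := translate_sub (translate_mem g) Dsh.
  exists v => _; apply: translate_fits; [|by rewrite /a /q; lia..].
  apply: (translate_saturated (translate_mem _)); apply: agree_le hv.
  by rewrite /a /q; lia.
move/choice: hnet => [v hv].
pose f B := (v B, net_code (net (act g x0) a (v B)) (a + q%:Z - 14 * k%:Z)
  (14 * k) B).
have finj : {in orb sact (stab sact D) A &, injective f}.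
  move=> B B' /set_mem oB /set_mem oB' [vv]; have := hv _ oB; have := hv _ oB'.
  by rewrite -vv => f1 f2; apply: (@fits_code_inj _ _ _ _ (14 * k));
    exact: mem_set.
have := @ncard_inj _ _ f _ setT finite_finset finj (fun _ _ => I).
by rewrite ncardT card_prod card_ffun !card_ord.
Qed.

(** A translate of [D] by the stabilizer of [A] still contains [A], hence the point [act h x0], and
    its level is close to that of [D]. *)
Lemma ncard_orb_large :
  (ncard (orb sact (stab sact A) D) <= @nfits n (14 * k))%N.
Proof.
apply: (@ncard_fits _ _ (act h x0) (i0 + l g - 7 * k%:Z)) => _ [s sA <-].
have sg := stab_translate_mul g sA; rewrite -sactM.
apply: translate_fits; [rewrite sactM|lia..].
have : A (act h x0) by exact: translate_mem.
by rewrite -{1}[A]sA => -[y Ay <-]; exists y => //; exact: AD.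
Qed.

(** The covering hypothesis puts a translate of [A] of level close to [l h] around each of n^q
    points of [D], and these translates are distinct. The translating elements need not stabilize
    [D], but they send it to boundedly many sets, whence the factor [nfits (24 * k)]. *)
Lemma ncard_orb_small_ge : l g + 3 * k%:Z <= l h ->
  (n ^ absz (l h - l g - 3 * k%:Z)%R <=
   @nfits n (24 * k) * ncard (orb sact (stab sact D) A))%N.
Proof.
(* [D] is saturated at level [a], so the net lies in [D]. Its points differ at level
   [a + q = i0 + l h - 2k], up to which all points of one translate agree. *)
move=> gh; set q := absz _; pose a := i0 + l g + k%:Z.
pose z (v : {ffun 'I_q -> 'I_n}) := net (act g x0) a v.
have /choice[s hs] : forall v, exists s, sact (s * h)%g A0 (z v) /\
    `|l (s * h)%g - l h| <= k%:Z.
  move=> v; have [u [uz ul]] := cov (z v) (l h).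
  by exists (u * h^-1)%g; rewrite mulgVK.
pose b := i0 + l g - 12 * k%:Z.
have fitD v : fits (act g x0) b (24 * k) (sact (s v) D).
  have [sz sl] := hs v.
  have Dz : D (z v).
    apply: (translate_saturated (translate_mem g)); exact: net_agree.
  have sDz : sact (s v * g)%g A0 (z v).
    by move: sz; rewrite !sactM => -[y Ay <-]; exists y => //; exact: AD.
  (* The error is [3k] for each of two products, [4k] for the inverse of [h] and [k] for the
     covering. *)
  have sg : `|l (s v * g)%g - l g| <= 11 * k%:Z.
    have := level_mul (s v) g; have := level_mul (s v * h)%g h^-1%g.
    by rewrite mulgK; have := level_inv h; lia.
  rewrite -sactM; have [zf ?] : fits (z v) b (24 * k) (sact (s v * g)%g A0).
    by apply: translate_fits; rewrite /b //; lia.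
  split=> // y /zf; apply: agree_trans.
  by apply: (@agree_le _ _ _ _ a); [rewrite /b /a; lia|exact: net_agree].
pose C := net_code (act g x0) b (24 * k).
(* One representative [r c] is fixed for each code [c]; [s v] preceded by the inverse of its
   representative stabilizes [D]. *)
have /choice[r hr] : forall c, exists t, forall v, C (sact (s v) D) = c ->
    sact t D = sact (s v) D.
  move=> c; have [[v hv]|no] := pselect (exists v, C (sact (s v) D) = c).
    exists (s v) => w hw; apply: (@fits_code_inj _ _ (act g x0) b (24 * k)).
    - exact/mem_set/fitD.
    - exact/mem_set/fitD.
    - by rewrite -/C hv hw.
  by exists 1%g => v hv; case: no; exists v.
pose f v := (C (sact (s v) D), sact ((r (C (sact (s v) D)))^-1 * s v)%g A).
have finj : {in setT &, injective f}.
  move=> v w _ _ [e]; rewrite !sactM e => /(act_inj (set_actP actP)) svw.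
  apply: net_inj; have [vz vl] := hs v; have [wz _] := hs w.
  move: wz; rewrite sactM -svw -sactM => /(translate_sub vz).
  by apply: agree_le; rewrite /a /q; lia.
have fin : finite_set (orb sact (stab sact D) A).
  exact: (commensurable_translate g h).1.
rewrite /nfits -[X in (_ <= X * _)%N]ncardT -ncardX//;
  last exact: finite_finset.
have -> : (n ^ q)%N = ncard [set: {ffun 'I_q -> 'I_n}].
  by rewrite ncardT card_ffun !card_ord.
apply: (@ncard_inj _ _ f) => // [|v _]; first exact: finite_setX finite_finset
  fin.
split=> //; exists ((r (C (sact (s v) D)))^-1 * s v)%g => //.
rewrite /stab/= sactM; apply: (canLR (actK (set_actP actP) _)).
by apply/esym/hr.
Qed.

End Nested.

Notation N := (n%:R : R).
Notation mod U V := (modular sact U V : R).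

Lemma natr_absz (z : int) : 0 <= z -> (n ^ absz z)%:R = N ^ z.
Proof. by move=> z0; rewrite natrX exprnP gez0_abs. Qed.

Lemma N_gt0 : 0 < N.
Proof. by rewrite ltr0n ltnW. Qed.

Lemma N_neq0 : N != 0.
Proof. by rewrite gt_eqF// N_gt0. Qed.

(** The denominator of [modular] lies between 1 and a constant, and its numerator is n^(l h - l g)
    up to a constant. The factor [P] absorbs the errors [8k] and [3k] in the exponents. *)
Lemma modular_nested : exists M : R, 0 < M /\
  forall g h, sact h A0 `<=` sact g A0 -> l g + 3 * k%:Z <= l h ->
    mod (sact g A0) (sact h A0) <= M * N ^ (l h - l g) /\
    N ^ (l h - l g) <= M * mod (sact g A0) (sact h A0).
Proof.
set M1 : R := (@nfits n (14 * k))%:R; set M2 : R := (@nfits n (24 * k))%:R.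
have M1_1 : 1 <= M1 by rewrite ler1n; apply/card_gt0P; exists finset.set0.
have M2_1 : 1 <= M2 by rewrite ler1n; apply/card_gt0P; exists finset.set0.
have N1 : 1 <= N by rewrite ler1n ltnW.
pose P := N ^+ (8 * k); have P1 : 1 <= P by rewrite exprn_ege1.
exists (M1 * M2 * P); split=> [|g h AD lgh].
  by rewrite !mulr_gt0// (lt_le_trans ltr01).
have [fin1 fin2] := commensurable_translate g h.
have := ncard_orb_small AD; have := ncard_orb_small_ge AD lgh.
have := ncard_orb_large AD.
have := orb_stab_gt0 (set_actP actP) fin2.
rewrite /modular; move: (ncard _) (ncard _) => o1 o2 o2_gt0.
rewrite -(ler_nat R) -/M1 => o2M.
rewrite -(ler_nat R) natrM natr_absz ?subr_ge0; last by lia.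
rewrite -/M2 => h1 h2; have {h2} := h2 ltac:(lia).
rewrite -(ler_nat R) natrM natr_absz -/M1; last by lia.
have {o2_gt0} o2_1 : 1 <= o2%:R :> R by rewrite ler1n.
have o2_gt0 : 0 < o2%:R :> R by exact: lt_le_trans o2_1.
have o1_ge0 : 0 <= o1%:R :> R by [].
move: (o1%:R : R) (o2%:R : R) o1_ge0 o2_1 o2_gt0 o2M h1 => a b a0 b1 b0 bM.
have -> : l h - l g + 8 * k%:Z = l h - l g + (8 * k)%N%:Z by clear; lia.
move=> h1; rewrite expfzDr ?N_neq0// -exprnP -/P => h2.
have E0 : 0 < N ^ (l h - l g) by rewrite exprz_gt0// N_gt0.
have {}h1 : N ^ (l h - l g) <= M2 * a * P.
  have {1}-> : l h - l g = l h - l g - 3 * k%:Z + (3 * k)%N%:Z.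
    by clear; lia.
  rewrite [X in X <= _]expfzDr ?N_neq0// -exprnP; apply: ler_pM => //.
  - by rewrite exprz_ge0.
  - by rewrite /P ler_weXn2l// leq_mul2r orbT.
move: (N ^ _) E0 h1 h2 => E E0 h1 h2.
have P0 : 0 < P := lt_le_trans ltr01 P1.
have M10 : 0 < M1 := lt_le_trans ltr01 M1_1.
have M20 : 0 < M2 := lt_le_trans ltr01 M2_1.
split.
  rewrite ler_pdivrMr//; apply: (le_trans h2).
  have -> : M1 * M2 * P * E * b = E * P * M1 * (M2 * b) by ring.
  by apply: ler_peMr; [rewrite !mulr_ge0// ltW|exact: mulr_ege1].
apply: (le_trans h1); have -> : M2 * a * P = M2 * P * b * (a / b).
  by field; rewrite gt_eqF.
have -> : M1 * M2 * P * (a / b) = M2 * P * M1 * (a / b) by ring.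
apply: ler_wpM2r; first by rewrite divr_ge0// ltW.
by apply: ler_wpM2l => //; rewrite mulr_ge0// ltW.
Qed.

Lemma modular_cell g h s :
  mod (sact g A0) (sact h A0) * mod (sact h A0) (sact s A0) =
  mod (sact g A0) (sact s A0).
Proof. by apply: (modular_cocycle (set_actP actP));
  exact: commensurable_translate. Qed.

(* Both [g A0] and [A0] are compared with a translate containing them. *)
Lemma modular_translate : exists M : R, 0 < M /\
  forall g, mod (sact g A0) A0 <= M * N ^ (- l g) /\
            N ^ (- l g) <= M * mod (sact g A0) A0.
Proof.
have [M [M0 hM]] := modular_nested.
have A01 : A0 = sact 1%g A0 by rewrite (set_actP actP).1.
pose P := N ^+ k; have P1 : 1 <= P by rewrite exprn_ege1// ler1n ltnW.
have P0 : 0 < P := lt_le_trans ltr01 P1.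
exists (M * M * P); split=> [|g]; first by rewrite !mulr_gt0.
have [j hj] := agree_ex x0 (act g x0).
(* Low enough for the translate given by [cov] to contain both [A0] and [g A0], and to lie at least
   [3k] below their levels, as [modular_nested] requires. *)
pose i := Num.min (Num.min (j - i0) 0 - 5 * k%:Z) (l g - 7 * k%:Z).
have [u [ux ul]] := cov x0 i.
have gu : sact g A0 `<=` sact u A0.
  move=> y /(translate_sub (translate_mem g)) gy.
  apply: (translate_saturated ux); apply: (agree_trans (y := act g x0)).
    by apply: agree_le hj; rewrite /i in ul; lia.
  by apply: agree_le gy; rewrite /i in ul; lia.
have ou : sact 1%g A0 `<=` sact u A0.
  rewrite -A01 => y xy; apply: (translate_saturated ux).
  by apply: agree_le xy; rewrite /i in ul; lia.
have [g1 g2] := hM u g gu ltac:(rewrite /i in ul; lia).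
have u1 : l u + 3 * k%:Z <= l 1%g by have l1 := level1; rewrite /i in ul; lia.
have [m1 m2] := hM u 1%g ou u1.
have d0 : 0 < mod (sact u A0) (sact g A0).
  by apply: (modular_gt0 (set_actP actP)); exact: commensurable_translate.
rewrite -A01 in m1 m2.
have -> : mod (sact g A0) A0 = mod (sact u A0) A0 / mod (sact u A0) (sact g A0).
  have := modular_cell u g 1%g; rewrite -A01 => <-.
  by rewrite mulrAC divff ?mul1r// gt_eqF.
move: (mod (sact u A0) _) (mod (sact u A0) _) d0 g1 g2 m1 m2 => c d d0.
rewrite !expfzDr ?N_neq0//.
have e0 : 0 < N ^ (- l u) by rewrite exprz_gt0// N_gt0.
have f0 : 0 < N ^ (- l g) by rewrite exprz_gt0// N_gt0.
have q0 : 0 < N ^ (l 1%g) by rewrite exprz_gt0// N_gt0.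
have fV : N ^ (l g) = (N ^ (- l g))^-1 by rewrite -invr_expz invrK.
have q1 : N ^ (l 1%g) <= P.
  by rewrite /P exprnP ler_weXz2l// ?ler1n ?(ltnW n1)//; have := level1; lia.
have q2 : 1 <= P * N ^ (l 1%g).
  rewrite /P exprnP -expfzDr ?N_neq0// -[X in X <= _](expr0z N).
  by rewrite ler_weXz2l// ?ler1n ?(ltnW n1)//; have := level1; lia.
move: q1 q2; rewrite fV.
move: (N ^ (- l u)) (N ^ (- l g)) (N ^ (l 1%g)) e0 f0 q0 {fV} => e f q e0 f0 q0
  q1 q2.
rewrite [_^-1 * e]mulrC !mulrA ler_pdivrMr// ler_pdivlMr// => g1 g2 m1 m2;
  split.
  rewrite ler_pdivrMr//; apply: (le_trans m1).
  have -> : M * M * P * f * d = M * (P * (M * d * f)) by ring.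
  rewrite -(mulrA M) ler_pM2l//; apply: ler_pM => //; exact: ltW.
rewrite ler_pdivlMr// mulrC; apply: (le_trans g1).
have -> : M * M * P * c = M * (P * (M * c)) by ring.
rewrite ler_pM2l//; apply: (@le_trans _ _ (P * (q * e))).
  by rewrite mulrA ler_peMl// ltW.
by rewrite ler_pM2l.
Qed.

End Modular.

(** * The invariant ultrametric and its tree of balls *)

Section RealAux.
Context {R : realType}.
Implicit Types a b t : R.

Lemma exprz_unbounded a b : 1 < a -> exists i : int, b < a ^ i.
Proof.
move=> a1; have a1' : 0 < a - 1 by rewrite subr_gt0.
have [j hj] : exists j : nat, b / (a - 1) < j%:R.
  exists (Num.bound `|b / (a - 1)|).
  by rewrite (le_lt_trans (ler_norm _))// archi_boundP.
exists j%:Z; rewrite -exprnP; move: hj; rewrite ltr_pdivrMr// => /lt_le_trans;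
  apply.
(* Bernoulli's inequality in the form j (a - 1) <= a^j. *)
elim: j => [|j ih]; first by rewrite mul0r expr0.
rewrite exprS -natr1 mulrDl mul1r.
have : 1 <= a ^+ j by rewrite exprn_ege1// ltW.
by nra.
Qed.

Lemma exprz_small a t : 1 < a -> 0 < t -> exists i : int, a ^ (- i) < t.
Proof.
move=> a1 t0; have [i hi] := exprz_unbounded t^-1 a1; exists i.
rewrite -invr_expz invf_plt//; first
  by rewrite posrE exprz_gt0// (lt_trans ltr01).
Qed.

Lemma exprz_floor a t : 1 < a -> 0 < t ->
  exists i : int, a ^ i <= t < a ^ (i + 1).
Proof.
move=> a1 t0; have [u hu] := exprz_unbounded t a1.
have [v hv] := exprz_small a1 t0.
have ex : exists j : nat, t < a ^ (j%:Z - v).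
  exists (absz (u + v)%R); apply: (lt_le_trans hu).
  by rewrite ler_weXz2l ?(ltW a1)//; lia.
have [[|j] hj jmin] := ex_minnP ex.
  by move: hj; rewrite sub0r ltNge ltW.
exists (j%:Z - v); rewrite (_ : _ + 1 = j.+1%:Z - v) ?hj ?andbT; last by lia.
by rewrite leNgt; apply/negP => /jmin; rewrite ltnn.
Qed.

Lemma finite_min (S : set R) a : finite_set S -> S a ->
  exists2 b, S b & forall c, S c -> b <= c.
Proof.
move=> finS Sa; have ha : a \in fset_set S by rewrite in_fset_set// inE.
case: (@arg_minP _ _ _ [` ha]%fset xpredT (fun b : fset_set S => val b)) => // b
  _ bmin.
exists (val b); first by apply/set_mem; rewrite -in_fset_set//; exact: valP.
move=> c Sc; have hc : c \in fset_set S by rewrite in_fset_set// inE.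
exact: (bmin [` hc]%fset).
Qed.

End RealAux.

(** * The modular homomorphism and the balls it makes equivariant *)

Section Delta.
Context {R : realType} {n : nat} {G : groupType}.
Context {act : G -> Qn R n -> Qn R n} {l : G -> int} {k : nat}.
Context {x0 : Qn R n} {i0 : int}.
Hypotheses (n1 : (1 < n)%N) (actP : group_action act).
Hypothesis (lP : quasilevel act l k).
Hypothesis cov : forall z i,
  exists g, set_act act g (cell x0 i0) z /\ `|l g - i| <= k%:Z.
Implicit Types (x y z : Qn R n) (i j : int) (U V : set (Qn R n)) (g h s : G).
Implicit Types r t : R.

Notation sact := (set_act act).
Notation A0 := (cell x0 i0).
Notation N := (n%:R : R).
Notation mod U V := (modular sact U V : R).

Definition Delta g : R := mod (sact g A0) A0.

Let comm U V : good U -> good V -> commensurable sact U V.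
Proof. exact: (good_commensurable n1 actP lP). Qed.

Let gact g U : good U -> good (sact g U).
Proof. exact: (good_set_act n1 actP lP). Qed.

Lemma modular_good U V W : good U -> good V -> good W ->
  mod U V * mod V W = mod U W.
Proof.
by move=> gU gV gW; apply: (modular_cocycle (set_actP actP)); exact: comm.
Qed.

Lemma modular_good_gt0 U V : good U -> good V -> 0 < mod U V.
Proof. by move=> gU gV; apply: (modular_gt0 (set_actP actP)); exact: comm. Qed.

Lemma modular_refl U : good U -> mod U U = 1.
Proof.
move=> gU; have U0 := modular_good_gt0 gU gU.
by apply: (mulfI (lt0r_neq0 U0)); rewrite modular_good// mulr1.
Qed.

Lemma modular_sact g U V :
  good U -> good V -> mod (sact g U) (sact g V) = mod U V.
Proof. by move=> gU gV; apply: (modular_act (set_actP actP)); exact: comm. Qed.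

(** By the cocycle identity, passing from [A0] to [B] introduces the factors [mod (g B) (g A0)] and
    [mod A0 B], whose product is 1 by invariance. *)
Lemma Delta_good g B : good B -> mod (sact g B) B = Delta g.
Proof.
move=> gB; have gA : good A0 by exact: good_cell.
rewrite /Delta -(modular_good (gact g gB) (gact g gA) gB) modular_sact//.
rewrite -(modular_good (gact g gA) gA gB) mulrCA modular_good//.
by rewrite modular_refl// mulr1.
Qed.

Lemma DeltaM g h : Delta (g * h)%g = Delta g * Delta h.
Proof.
have gA : good A0 by exact: good_cell.
rewrite /Delta (set_actP actP).2.
rewrite -(modular_good (gact g (gact h gA)) (gact g gA) gA).
by rewrite modular_sact //; [exact: mulrC|exact: gact].
Qed.

Lemma Delta_gt0 g : 0 < Delta g.
Proof. by apply: modular_good_gt0; [apply: gact|]; exact: good_cell. Qed.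

Lemma Delta1 : Delta 1%g = 1.
Proof. by rewrite /Delta (set_actP actP).1 modular_refl//; exact: good_cell.
Qed.

Lemma DeltaV g : Delta g^-1%g = (Delta g)^-1.
Proof.
by apply: (mulfI (lt0r_neq0 (Delta_gt0 g))); rewrite -DeltaM mulgV Delta1
  divff// gt_eqF// Delta_gt0.
Qed.

(* The balls of the metric [sup_h d(hx, hy) / Delta h], which the action
   multiplies exactly by [Delta]. *)
Definition qnear r x y := forall h, mdist (act h x) (act h y) <= r * Delta h.

Definition nball r x := [set y | qnear r x y].

Lemma qnear_sym r x y : qnear r x y -> qnear r y x.
Proof. by move=> h s; rewrite metric_sym. Qed.

Lemma mdist_ultra t x y z : mdist x y <= t -> mdist y z <= t -> mdist x z <= t.
Proof.
have [->|/eqP xy] := eqVneq x y => //.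
have [<-|/eqP yz] := eqVneq y z => //.
have [la ha] := agree_level xy; have [lb hb] := agree_level yz.
rewrite (mdist_level xy ha) (mdist_level yz hb) => at_ bt.
have : mdist x z <= N ^ (- (Num.min la lb)).
  apply/mdist_agree => //; apply: (agree_trans (y := y)).
    by apply/ha; rewrite ge_min lexx.
  by apply/hb; rewrite ge_min lexx orbT.
by move=> /le_trans; apply; rewrite minEle; case: ifP.
Qed.

Lemma qnear_trans r x y z : qnear r x y -> qnear r y z -> qnear r x z.
Proof. by move=> xy yz h; exact: mdist_ultra (xy h) (yz h). Qed.

Lemma qnear_le r t x y : r <= t -> qnear r x y -> qnear t x y.
Proof.
by move=> rt xy h; rewrite (le_trans (xy h))// ler_wpM2r// ltW// Delta_gt0.
Qed.

Lemma qnear_refl r x : 0 <= r -> qnear r x x.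
Proof. by move=> r0 h; rewrite mdistxx mulr_ge0// ltW// Delta_gt0. Qed.

Lemma qnear_mdist r x y : qnear r x y -> mdist x y <= r.
Proof. by move=> /(_ 1%g); rewrite !(act1 actP) Delta1 mulr1. Qed.

Lemma qnear_act g r x y :
  qnear (r * Delta g) (act g x) (act g y) <-> qnear r x y.
Proof.
split=> h s; last by rewrite -mulrA -[_ * Delta s]mulrC -DeltaM -!(actM actP).
have := h (s * g^-1)%g; rewrite !(actM actP) !(actK actP).
by rewrite DeltaM DeltaV mulrACA divff ?mulr1 ?gt_eqF ?Delta_gt0.
Qed.

Lemma nball_eq r x y : qnear r x y -> nball r x = nball r y.
Proof.
move=> xy; apply/seteqP; split=> z; apply: qnear_trans => //; exact: qnear_sym.
Qed.

Lemma sact_nball g r x : sact g (nball r x) = nball (r * Delta g) (act g x).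
Proof.
apply/seteqP; split=> [_ [y xy <-]|y]; first by rewrite /nball/=;
  apply/qnear_act.
move=> h; apply/(mem_set_actV actP); rewrite /nball/=.
by apply/(qnear_act g); rewrite (actVK actP).
Qed.

(** Each [h] takes the pair to distance at most n^(k - l h - i), and n^(- l h) is at most a constant
    times [Delta h] by [modular_translate]. With [qnear_mdist], this makes the new ultrametric
    bilipschitz to the old distance. *)
Lemma agree_qnear : exists c, 0 < c /\
  forall x y i, agree_upto x y i -> qnear (c * N ^ (- i)) x y.
Proof.
have [M [M0 hM]] := modular_translate n1 actP lP cov.
exists (M * N ^ k%:Z); split=> [|x y i xy h]; first
  by rewrite mulr_gt0// exprz_gt0// N_gt0.
have : mdist (act h x) (act h y) <= N ^ (- (i + l h - k%:Z)).
  by apply/mdist_agree => //; apply: (quasi_fwd lP xy).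
move=> /le_trans; apply; have [_ hl] := hM h.
have -> : - (i + l h - k%:Z) = k%:Z - i - l h by lia.
rewrite !expfzDr ?N_neq0// -mulrA [M * _]mulrC -!mulrA.
rewrite ler_pM2l ?exprz_gt0 ?N_gt0// mulrCA ler_pM2l ?exprz_gt0 ?N_gt0//.
Qed.

(** All these balls lie in one cell and are saturated at one common level. *)
Lemma finite_nballs (S : set R) x u v :
  0 < u -> (forall r, S r -> u <= r <= v) ->
  {in S &, injective (fun r => nball r x)} -> finite_set S.
Proof.
move=> u0 Suv Sinj; have [c [c0 hc]] := agree_qnear.
have N1 : 1 < N by rewrite ltr1n.
have [i hi] := exprz_unbounded v N1.
have [j hj] : exists j : int, N ^ (- j) < u / c by apply: exprz_small;
  rewrite ?divr_gt0.
apply: (finite_inj (finite_fits x (- i) (absz (j + i)%R)) Sinj) => r /Suv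
  /andP[ur rv].
split=> [y /qnear_mdist yr|y z xy yz].
  by apply/mdist_agree => //; rewrite opprK (le_trans yr)// (le_trans rv)// ltW.
apply: qnear_trans xy _; apply: qnear_le (hc _ _ j _).
  by apply: ltW; apply: lt_le_trans ur; rewrite mulrC -ltr_pdivlMr.
by apply: agree_le yz; lia.
Qed.

(** * Discreteness of the scales and regularity of the tree *)

Section Scales.
Variable c : R.
Hypothesis c_gt0 : 0 < c.
Hypothesis hc : forall x y i, agree_upto x y i -> qnear (c * N ^ (- i)) x y.

(** With this radius the reference ball contains [A0], so the covering hypothesis passes to its
    translates. *)
Let rho := c * N ^ (- i0).

Let rho_gt0 : 0 < rho.
Proof. by rewrite mulr_gt0// exprz_gt0// N_gt0. Qed.

(* [scales x] are the [Delta g] for which the translate [g B] of the reference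
   ball [B] contains [x]; this translate is then the ball of radius
   [rho * Delta g] around [x]. *)
Notation B := (nball rho x0).

Definition scales x : set R :=
  [set r | exists2 g, Delta g = r & qnear (rho * r) (act g x0) x].

Let good_nball r x : 0 < r -> good (nball r x).
Proof.
move=> r0; have N1 : 1 < N by rewrite ltr1n.
split; first by exists x; apply: qnear_refl; exact: ltW.
  have [i hi] := exprz_unbounded r N1; exists (- i) => y xy z xz.
  apply/mdist_agree => //; rewrite opprK; apply: le_trans (ltW hi).
  by apply: qnear_mdist; apply: qnear_trans xz; exact: qnear_sym.
have [j hj] : exists j : int, N ^ (- j) < r / c by apply: exprz_small;
  rewrite ?divr_gt0.
exists j => y z xy /hc yz; apply: qnear_trans xy _; apply: qnear_le yz.
by rewrite mulrC -ler_pdivlMr// ltW.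
Qed.

Lemma scales_gt0 x r : scales x r -> 0 < r.
Proof. by move=> [g <- _]; exact: Delta_gt0. Qed.

Lemma scalesP x r :
  scales x r <-> exists2 g, Delta g = r & sact g B = nball (rho * r) x.
Proof.
split=> -[g gr h]; exists g => //.
  by rewrite sact_nball gr; exact: nball_eq.
rewrite sact_nball gr in h; have r0 : 0 <= rho * r.
  by rewrite -gr mulr_ge0// ltW// Delta_gt0.
by have : nball (rho * r) x x by [exact: qnear_refl]; rewrite -h.
Qed.

Lemma scales_act g x r : scales x r -> scales (act g x) (Delta g * r).
Proof.
move=> [h hr hx]; exists (g * h)%g; first by rewrite DeltaM hr.
by rewrite (actM actP) mulrCA mulrC; apply/qnear_act.
Qed.

Lemma scales_actV g x r : scales (act g x) (Delta g * r) -> scales x r.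
Proof.
move=> /(@scales_act g^-1%g); rewrite (actK actP) DeltaV mulKf//.
by rewrite gt_eqF// Delta_gt0.
Qed.

Lemma scales_qnear x y r t : qnear (rho * r) x y -> r <= t -> scales x t ->
  scales y t.
Proof.
move=> xy rt [g gt h]; exists g => //; apply: qnear_trans h _.
by apply: qnear_le xy; rewrite ler_pM2l.
Qed.

Lemma scales_Delta g : scales (act g x0) (Delta g).
Proof. by exists g => //; apply: qnear_refl; rewrite mulr_ge0// ltW// Delta_gt0.
Qed.

Lemma scales_level x i : exists2 g, scales x (Delta g) & `|l g - i| <= k%:Z.
Proof.
have [g [[y Ay <-] gi]] := cov x i; exists g => //; exists g => //.
by rewrite qnear_act; exact: hc.
Qed.

Lemma scales_small x t : 0 < t -> exists2 r, scales x r & r < t.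
Proof.
move=> t0; have [M [M0 hM]] := modular_translate n1 actP lP cov.
have [i hi] : exists i : int, N ^ (- i) < t / M.
  by apply: exprz_small; rewrite ?ltr1n ?divr_gt0.
have [g gx gi] := scales_level x (i + k%:Z); exists (Delta g) => //.
apply: le_lt_trans (hM g).1 _; rewrite mulrC -ltr_pdivlMr//;
  apply: le_lt_trans hi.
by rewrite ler_weXz2l ?ler1n ?(ltnW n1)//; lia.
Qed.

Lemma scales_large x t : exists2 r, scales x r & t < r.
Proof.
have [M [M0 hM]] := modular_translate n1 actP lP cov.
have [i hi] : exists i : int, M * t < N ^ i.
  by apply: exprz_unbounded; rewrite ltr1n.
have [g gx gi] := scales_level x (- i - k%:Z); exists (Delta g) => //.
rewrite -(ltr_pM2l M0); apply: lt_le_trans hi _; apply: le_trans (hM g).2.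
by rewrite ler_weXz2l ?ler1n ?(ltnW n1)//; lia.
Qed.

(** The set [g B] determines [Delta g] by [Delta_good], so distinct scales at [x] give distinct
    balls around [x], and [finite_nballs] applies. *)
Lemma scales_finite x u v : 0 < u ->
  finite_set (scales x `&` [set r | u <= r <= v]).
Proof.
move=> u0; set S := _ `&` _.
have inj : {in [set rho * r | r in S] &, injective (fun r => nball r x)}.
  move=> _ _ /set_mem[r [/scalesP[g gr gB] _] <-] /set_mem[t [/scalesP[h ht hB]
    _] <-] e.
  congr (_ * _); rewrite -gr -ht -(Delta_good g (good_nball x0 rho_gt0)).
  by rewrite -(Delta_good h (good_nball x0 rho_gt0)) gB hB e.
have fin : finite_set [set rho * r | r in S].
  apply: (@finite_nballs _ x (rho * u) (rho * v)) => //; first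
    by rewrite mulr_gt0.
  by move=> _ [r [_ /andP[ur rv]] <-]; rewrite !ler_pM2l// ur.
apply: (finite_inj fin (f := fun r => rho * r)).
  by move=> r t _ _ /(mulfI (lt0r_neq0 rho_gt0)).
by move=> r Sr; exists r.
Qed.

(** By local finiteness there is a first scale above 1; it will be the ratio of consecutive radii in
    the tree. *)
Lemma scale_step : exists lam, [/\ 1 < lam, scales x0 lam &
  forall t, scales x0 t -> 1 < t -> lam <= t].
Proof.
have [r hr r1] := scales_large x0 1.
have fin := scales_finite x0 r ltr01.
have [||lam [hlam /andP[l1 lr]] lmin] :=
    @finite_min R (scales x0 `&` [set t | 1 < t <= r]) r.
- apply: sub_finite_set fin => t [xt /andP[t1 tr]].
  by split=> //=; rewrite tr (ltW t1).
- by split=> //=; rewrite r1 lexx.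
exists lam; split=> // t ht t1.
have [tr|rt] := leP t r; first by apply: lmin; split=> //=; rewrite t1.
exact: le_trans lr (ltW rt).
Qed.

Section Step.
Variable lam : R.
Hypotheses (lam1 : 1 < lam) (hlam : scales x0 lam).
Hypothesis lam_min : forall t, scales x0 t -> 1 < t -> lam <= t.

Let lam_gt0 : 0 < lam := lt_trans ltr01 lam1.

(** If [Delta g = r] and [g B] contains [x], then the scales at [x] from [r] on agree with those at
    [act g x0], which are [r] times the scales at [x0]. *)
Lemma scales_next x r : scales x r -> scales x (r * lam) /\
  forall t, scales x t -> r < t -> r * lam <= t.
Proof.
move=> xr; have r0 := scales_gt0 xr; move: xr => [g gr gx]; split.
  apply: (scales_qnear gx); first by rewrite ler_peMr// ltW.
  by rewrite -gr; exact: scales_act.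
move=> t xt rt; rewrite mulrC -ler_pdivlMr//; apply: lam_min; last first.
  by rewrite ltr_pdivlMr// mul1r.
apply: (@scales_actV g); rewrite gr mulrCA divff ?mulr1 ?gt_eqF//.
by apply: scales_qnear xt; [exact: qnear_sym gx|exact: ltW].
Qed.

(** The largest scale below [r] has a successor, larger by the factor [lam], which must be [r]. *)
Lemma scales_prev x r : scales x r -> scales x (r / lam).
Proof.
move=> xr; have r0 := scales_gt0 xr; have [u xu ur] := scales_small x r0.
have u0 := scales_gt0 xu; have fin := scales_finite x r u0.
(* Negated, so that [finite_min] yields a maximum. *)
pose S := [set - t | t in scales x `&` [set t | u <= t < r]].
have finS : finite_set S.
  apply: finite_image; apply: sub_finite_set fin => t [xt /andP[ut tr]].
  by split=> //=; rewrite ut ltW.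
have [||_ [t [xt /andP[ut tr]] <-] tmax] := @finite_min R S (- u) => //.
  by exists u => //; split=> //=; rewrite lexx.
have [xtl hmin] := scales_next xt.
have : t * lam <= r by exact: hmin.
rewrite le_eqVlt => /orP[/eqP <-|tlr]; first by rewrite mulfK// gt_eqF.
have tl : t < t * lam by rewrite ltr_pMr// (scales_gt0 xt).
have : - t <= - (t * lam).
  by apply: tmax; exists (t * lam) => //; split=> //=;
    rewrite tlr (le_trans ut)// ltW.
by rewrite lerN2 leNgt tl.
Qed.

Lemma scales_exprz x r i : scales x r -> scales x (r * lam ^ i).
Proof.
have pos (j : nat) : scales x r -> scales x (r * lam ^ j%:Z).
  elim: j => [|j ih] xr; first by rewrite mulr1.
  by rewrite -exprnP exprSr mulrA; have [] := scales_next (ih xr).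
have neg (j : nat) : scales x r -> scales x (r * lam ^ (- j%:Z)).
  elim: j => [|j ih] xr; first by rewrite mulr1.
  have := ih xr; rewrite -!invr_expz -!exprnP exprSr invfM mulrA.
  exact: scales_prev.
by case: (intP i) => [|j|j]; [exact: (pos 0)|exact: pos|exact: neg].
Qed.

Lemma scales_power x r i : scales x (lam ^ i) -> scales x r ->
  exists j, r = lam ^ j.
Proof.
move=> xi xr; have [j /andP[jr rj]] := exprz_floor lam1 (scales_gt0 xr).
exists j; apply/eqP; rewrite eq_le jr andbT leNgt; apply/negP => jr'.
have xj : scales x (lam ^ j).
  have := scales_exprz (j - i) xi; rewrite -expfzDr ?gt_eqF//.
  by rewrite addrC subrK.
have [_ /(_ _ xr jr')] := scales_next xj.
by rewrite -[X in _ * X]expr1z -expfzDr ?gt_eqF// leNgt rj.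
Qed.

(** Since 1 is a scale at [x0], all scales there are powers of [lam]. A large enough scale at [x] is
    also one at [x0], hence a power of [lam], and steps from it reach all other powers. *)
Lemma scales_lam x i : scales x (lam ^ i).
Proof.
have x01 : scales x0 1 by rewrite -Delta1 -{1}(act1 actP x0);
  exact: scales_Delta.
have [j xj] := agree_ex x0 x; have xx0 := hc xj.
pose t := c * N ^ (- j) / rho.
have [r xr tr] := scales_large x t.
have x0r : scales x0 r.
  apply: (@scales_qnear x _ t) xr; last exact: ltW.
  by apply: qnear_sym; rewrite mulrCA divff ?mulr1// gt_eqF.
have [e re] := @scales_power x0 r 0 x01 x0r.
have := scales_exprz (i - e) xr; rewrite re -expfzDr ?gt_eqF//.
by rewrite addrC subrK.
Qed.

Lemma Delta_power g : exists i, Delta g = lam ^ i.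
Proof. by apply: (@scales_power (act g x0) _ 0);
  [exact: scales_lam|exact: scales_Delta]. Qed.

Definition children i x : set (set (Qn R n)) :=
  [set nball (rho * lam ^ (i - 1)) y | y in nball (rho * lam ^ i) x].

(** For a ball [P] and a child [C], [mod P C] is computed twice. The stabilizer of [P] is transitive
    on the children and that of [C] fixes [P], so it is the number of children; by the cocycle
    through [B] it is lam^i / lam^(i - 1). *)
Lemma ncard_children i x : finite_set (children i x) /\
  (ncard (children i x))%:R = lam.
Proof.
set P := nball (rho * lam ^ i) x; set C := nball (rho * lam ^ (i - 1)) x.
have lam0 j : 0 < rho * lam ^ j by rewrite mulr_gt0// exprz_gt0.
have gP : good P by exact: good_nball.
have gC : good C by exact: good_nball.
have gB : good B by exact: good_nball.
have sub j : rho * lam ^ (j - 1) <= rho * lam ^ j.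
  by rewrite ler_pM2l// ler_weXz2l ?(ltW lam1)//; lia.
have stabC g : Delta g = 1 -> forall j z y, qnear (rho * lam ^ j) (act g z) y ->
    sact g (nball (rho * lam ^ j) z) = nball (rho * lam ^ j) y.
  by move=> g1 j z y zy; rewrite sact_nball g1 mulr1; exact: nball_eq.
(* Both balls are translates of [B] at the same scale, so the element between them has [Delta] equal
   to 1. *)
have trans y : P y ->
    exists2 g, Delta g = 1 & sact g C = nball (rho * lam ^ (i - 1)) y.
  move=> Py; have /scalesP[g gr gC'] := scales_lam x (i - 1).
  have /scalesP[h hr hC] := scales_lam y (i - 1).
  exists (h * g^-1)%g; first by rewrite DeltaM DeltaV gr hr divff// expfz_neq0//
    gt_eqF.
  rewrite /C -gC' (set_actP actP).2 (actK (set_actP actP)).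
  exact: hC.
have Dstab g j y : stab sact (nball (rho * lam ^ j) y) g -> Delta g = 1.
  by move=> gj; rewrite -(Delta_good g (good_nball y (lam0 j))) gj
    modular_refl//; exact: good_nball.
have Cx : C x by apply: qnear_refl; exact: ltW.
have orbP : orb sact (stab sact P) C = children i x.
  apply/seteqP; split=> [_ [g gP' <-]|_ [y Py <-]].
    exists (act g x); last by rewrite /C sact_nball (Dstab _ _ _ gP') mulr1.
    by rewrite -/P -[P]gP'; exists x => //; apply: qnear_refl; exact: ltW.
  have [g g1 gC'] := trans y Py; exists g => //.
  apply: stabC => //; have : nball (rho * lam ^ (i - 1)) y (act g x)
    by rewrite -gC'; exists x.
  by move=> yx; apply: qnear_sym; apply: qnear_trans Py _;
    exact: qnear_le (sub i) yx.
have orbC : orb sact (stab sact C) P = [set P].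
  apply/seteqP; split=> [_ [g gC' <-]|_ ->] /=; last first.
    by exists 1%g; rewrite ?(set_actP actP).1// /stab/=;
      exact: (set_actP actP).1.
  apply: stabC (Dstab _ _ _ gC') _ _ _ _; apply: qnear_sym;
    apply: qnear_le (sub i) _.
  by change (C (act g x)); rewrite -[C]gC'; exists x.
have [fin _] := comm gP gC; rewrite orbP in fin; split=> //.
have /scalesP[g gr gC'] := scales_lam x (i - 1).
have /scalesP[h hr hP] := scales_lam x i.
have : mod P C = lam.
  rewrite -(modular_good gP gB gC) /P -hP Delta_good// /C -gC'.
  rewrite -(modular_sact g^-1%g gB (gact g gB)) (actK (set_actP actP)).
  rewrite Delta_good// DeltaV.
  rewrite hr gr invr_expz -expfzDr ?gt_eqF//.
  by have -> : i + - (i - 1) = 1 by lia.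
by rewrite /modular orbP orbC ncard1 divr1.
Qed.

End Step.

End Scales.

End Delta.

(** * Coordinates in Q_m *)

(** Digit [i] of the limit is read at stage [T i], from which on it is constant. All negative digits
    can be read at the single stage [T 0], so they vanish towards minus infinity. *)
Lemma Qn_complete (R : realType) (n : nat) (xs : nat -> Qn R n) :
  (forall i, exists t, forall s, (t <= s)%N -> agree_upto (xs t) (xs s) i) ->
  exists x, forall i, exists t, forall s, (t <= s)%N -> agree_upto x (xs s) i.
Proof.
move=> /choice[T hT].
have eqT i j s : i <= j -> (T j <= s)%N -> xs (T i) i = xs s i.
  move=> ij js; rewrite (hT i (maxn s (T i)))// ?leq_maxr//.
  rewrite -(hT j (maxn s (T i))) ?(leq_trans js) ?leq_maxl//.
  by rewrite (hT j s).
have ev0 : exists k : int, forall i, i < k -> xs (T i) i = 0 :> nat.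
  have [k hk] := digit_ev0 (xs (T 0)); exists (Num.min k 0) => i.
  by rewrite lt_min => /andP[ik i0]; rewrite (eqT i 0 (T 0)) ?(ltW i0)// hk.
exists (MkQn R ev0) => i; exists (T i) => s ts j ji /=; exact: eqT ts.
Qed.

(** A prescribed element is put first in the enumeration, so that the branch of the base point can
    carry the digit 0. *)
Lemma labelling (T : choiceType) (m : nat) (S : set T) (s0 : T) :
  finite_set S -> ncard S = m -> (0 < m)%N ->
  exists f : T -> 'I_m, [/\ {in S &, injective f},
    forall d, exists2 s, S s & f s = d & S s0 -> f s0 = 0 :> nat].
Proof.
case: m => // m finS Sm _; pose e := enum_fset (fset_set S).
have memS s : (s \in e) = (s \in S) by rewrite in_fset_set.
have [t [ut memt t0]] : exists t, [/\ uniq t, t =i e & S s0 -> index s0 t = 0].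
  have [Ss0|nS] := pselect (S s0); last by exists e; split=> //;
    exact: fset_uniq.
  have s0e : s0 \in e by rewrite memS inE.
  have ue : uniq (s0 :: rem s0 e) by rewrite -(perm_uniq (perm_to_rem s0e))
    fset_uniq.
  exists (s0 :: rem s0 e); split=> //=; last by rewrite eqxx.
  by move=> s; rewrite -(perm_mem (perm_to_rem s0e)).
have st : size t = m.+1.
  rewrite -Sm; apply/perm_size/uniq_perm => //; exact: fset_uniq.
have it s : S s -> (index s t < m.+1)%N.
  by move=> Ss; rewrite -st index_mem memt memS inE.
exists (fun s => inord (index s t)); split=> [s s' /set_mem Ss /set_mem
  Ss'|d|Ss0].
- move=> /(congr1 val) /=; rewrite !inordK ?it// => /(congr1 (nth s t)).
  by rewrite !nth_index// memt memS inE.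
- exists (nth s0 t d); first by apply/set_mem; rewrite -memS -memt mem_nth ?st.
  by rewrite index_uniq ?st// inord_val.
by rewrite /= t0// inordK.
Qed.

Section Coordinates.
Context {R : realType} {n m : nat}.
Hypotheses (n1 : (1 < n)%N) (m1 : (1 < m)%N).
Variables (eqv : int -> Qn R n -> Qn R n -> Prop) (x0 : Qn R n).
Implicit Types (x y z : Qn R n) (i j : int).
Hypothesis eqv_refl : forall i x, eqv i x x.
Hypothesis eqv_sym : forall i x y, eqv i x y -> eqv i y x.
Hypothesis eqv_trans : forall i y x z, eqv i x y -> eqv i y z -> eqv i x z.
Hypothesis eqv_le : forall i j x y, j <= i -> eqv i x y -> eqv j x y.
Variable c : R.
Hypothesis c_gt0 : 0 < c.
Hypothesis eqv_mdist : forall i x y, eqv i x y -> mdist x y <= c * m%:R ^ (- i).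
Hypothesis mdist_eqv : forall i x y, mdist x y <= c^-1 * m%:R ^ (- i) ->
  eqv i x y.

Definition cls i x : set (Qn R n) := [set y | eqv i x y].

Definition subcls j (P : set (Qn R n)) : set (set (Qn R n)) :=
  [set cls j y | y in P].

Hypothesis branching : forall j x,
  finite_set (subcls j (cls (j - 1) x)) /\ ncard (subcls j (cls (j - 1) x)) = m.

Lemma clsP i x y : cls i x = cls i y <-> eqv i x y.
Proof.
split=> [e|xy]; first by have : cls i y y by [exact: eqv_refl]; rewrite -e.
by apply/seteqP; split=> z; apply: eqv_trans => //; exact: eqv_sym.
Qed.

Let N1 : 1 < n%:R :> R. Proof. by rewrite ltr1n. Qed.
Let M1 : 1 < m%:R :> R. Proof. by rewrite ltr1n. Qed.
Let M0 : 0 < m%:R :> R. Proof. by rewrite ltr0n ltnW. Qed.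

Lemma eqv_eq x y : (forall i, eqv i x y) -> x = y.
Proof.
move=> xy; apply/eqP; rewrite -[_ == _]negbK -mdist_gt0; apply/negP => d0.
have [i hi] := exprz_small M1 (divr_gt0 d0 c_gt0).
have := eqv_mdist (xy i); rewrite leNgt => /negP; apply.
by rewrite mulrC -ltr_pdivlMr.
Qed.

Lemma agree_eqv i : exists j, forall x y, agree_upto x y j -> eqv i x y.
Proof.
have t0 : 0 < c^-1 * m%:R ^ (- i) by rewrite mulr_gt0 ?invr_gt0 ?exprz_gt0.
have [j hj] := exprz_small N1 t0; exists j => x y /(mdist_agree _ _ _ n1) xy.
by apply: mdist_eqv; apply: le_trans xy (ltW hj).
Qed.

Lemma eqv_agree j : exists i, forall x y, eqv i x y -> agree_upto x y j.
Proof.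
have t0 : 0 < n%:R ^ (- j) / c :> R by rewrite divr_gt0 ?exprz_gt0//
  (lt_trans ltr01).
have [i hi] := exprz_small M1 t0; exists i => x y /eqv_mdist xy.
apply/mdist_agree => //; apply: le_trans xy _.
by rewrite mulrC -ler_pdivlMr// ltW.
Qed.

Lemma eqv_ex x y : exists i, eqv i x y.
Proof.
have [i hi] := exprz_unbounded (c * mdist x y) M1; exists (- i).
by apply: mdist_eqv; rewrite opprK mulrC ler_pdivlMr// mulrC ltW.
Qed.

(** Digit [j] of [f x] labels the class of [x] at level [j] among the [m] subclasses of its class at
    level [j - 1]. The class of [x0] has label 0, and every [x] shares its classes with [x0] at low
    levels, so its digits vanish there. *)
Lemma coordinates_ex : exists f : Qn R n -> Qn R m,
  bijective f /\ forall x y i, agree_upto (f x) (f y) i <-> eqv i x y.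
Proof.
have /choice[L hL] : forall p : int * set (Qn R n),
    exists g : set (Qn R n) -> 'I_m, (exists x, p.2 = cls (p.1 - 1) x) ->
    [/\ {in subcls p.1 p.2 &, injective g},
      forall d, exists2 y, p.2 y & g (cls p.1 y) = d &
      p.2 x0 -> g (cls p.1 x0) = 0 :> nat].
  move=> [j P] /=; have [[x ->]|no] := pselect (exists x, P = cls (j - 1) x);
    last first.
    (* An arbitrary labelling for sets that are not classes. *)
    by exists (fun=> Ordinal (ltnW m1)).
  have [fin cm] := branching j x.
  have [g [gi gs g0]] := labelling (cls j x0) fin cm (ltnW m1).
  exists g => _; split=> // [d|Px0]; last by apply: g0; exists x0.
  by have [_ [y Py <-] yd] := gs d; exists y.
pose dig x j : 'I_m := L (j, cls (j - 1) x) (cls j x).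
have dig_eqv x y i j : j <= i -> eqv i x y -> dig x j = dig y j.
  move=> ji xy; rewrite /dig.
  have /clsP -> : eqv (j - 1) x y by apply: eqv_le xy; lia.
  by have /clsP -> : eqv j x y by apply: eqv_le xy.
have dig0 j : dig x0 j = 0 :> nat.
  by have [_ _ ->] := hL (j, cls (j - 1) x0) (ex_intro _ x0 erefl) => //;
    exact: eqv_refl.
have dig_inj x y j : eqv (j - 1) x y -> dig x j = dig y j -> eqv j x y.
  move=> xy; rewrite /dig; have /clsP exy := xy; rewrite -exy => e.
  have [inj _ _] := hL (j, cls (j - 1) x) (ex_intro _ x erefl).
  by apply/clsP; apply: inj e; apply/mem_set;
    [exists x; first exact: eqv_refl|exists y].
have ev0 x : exists k : int, forall j, j < k -> dig x j = 0 :> nat.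
  have [k xk] := eqv_ex x x0; exists k => j /ltW jk.
  by rewrite (dig_eqv _ _ _ _ jk xk).
pose f x := MkQn R (ev0 x); exists f.
have fP x y i : agree_upto (f x) (f y) i <-> eqv i x y.
  split=> [h|xy j ji]; last exact: dig_eqv xy.
  have [k xk] := eqv_ex x y.
  (* Upwards from a level where [x] and [y] are equivalent, equal digits keep them in the same
     class. *)
  have up t : k + t%:Z <= i -> eqv (k + t%:Z) x y.
    elim: t => [|t ih] ti; first by rewrite addr0.
    apply: dig_inj; last by apply: (h (k + t.+1%:Z)).
    by have -> : k + t.+1%:Z - 1 = k + t%:Z by [lia]; apply: ih; lia.
  have [ik|/ltW ki] := leP i k; first exact: eqv_le xk.
  by have := up (absz (i - k)%R); have -> : k + `|i - k|%N = i by [lia]; exact.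
split=> //.
have finj : injective f.
  by move=> x y e; apply: eqv_eq => i; apply/fP; rewrite e; exact: agree_refl.
have fsurj u : exists x, f x = u.
  have [k hk] := digit_ev0 u.
  (* Points with the digits of [u] below [k + t], starting from [x0], whose digits are all 0; their
     limit is sent to [u]. *)
  have /choice[xs hxs] : forall t : nat, exists x, forall i, i < k + t%:Z ->
    f x i = u i.
    elim=> [|t [x hx]].
      by exists x0 => i; rewrite addr0 => ik; apply: val_inj;
        rewrite /= hk// dig0.
    pose j := k + t%:Z.
    have [_ /(_ (u j))[y xy yd] _] := hL (j, cls (j - 1) x) (ex_intro _ x
      erefl).
    exists y => i ij; have [ij'|ji] := ltP i j.
      rewrite -hx//; apply: esym; have /fP := xy; apply; lia.
    have -> : i = j by rewrite /j in ji *; lia.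
    by rewrite -yd /= /dig; have /clsP -> := xy.
  have xs_eqv t s : (t <= s)%N -> eqv (k + t%:Z - 1) (xs t) (xs s).
    by move=> ts; apply/fP => i it; rewrite !hxs//; lia.
  have [x hx] : exists x, forall i, exists t, forall s, (t <= s)%N ->
    agree_upto x (xs s) i.
    apply: Qn_complete => j; have [i hi] := eqv_agree j.
    exists (absz (i - k + 1)%R) => s ts; apply: hi;
      apply: eqv_le (xs_eqv _ _ ts).
    lia.
  exists x; apply: agree_eq => i.
  have [j hj] := agree_eqv i; have [t ht] := hx j.
  pose s := maxn t (absz (i - k + 1)%R).
  have /fP xi : eqv i x (xs s) by apply: hj; apply: ht; exact: leq_maxl.
  apply: agree_trans xi _ => a ai; apply: hxs.
  have : (absz (i - k + 1)%R <= s)%N by rewrite leq_maxr.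
  lia.
have /choice[g hg] := fsurj.
by exists g => [x|u]; [apply: finj; rewrite hg|exact: hg].
Qed.

End Coordinates.

(** * Levels from the metric hypotheses *)

Lemma Qn_point (R : realType) (n : nat) : (0 < n)%N -> exists x : Qn R n, True.
Proof.
move=> n0; have ev0 : exists k : int, forall i : int, i < k ->
  (fun=> Ordinal n0) i = 0 :> nat.
  by exists 0.
by exists (MkQn R ev0).
Qed.

(** The level [l g] is read off the image of one fixed pair of exact level 0. The quasisimilarity
    bound compares every other pair with it in both directions, and K <= n^k turns the bound into an
    additive error [k]. *)
Lemma quasisimilarity_level (R : realType) (n : nat) (G : Type)
    (act : G -> Qn R n -> Qn R n) (K : R) : (1 < n)%N ->
  (forall g, quasisimilarity K (act g)) -> exists l k, quasilevel act l k.
Proof.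
move=> n1 qs; have N1 : 1 < n%:R :> R by rewrite ltr1n.
have N0 : n%:R != 0 :> R by rewrite gt_eqF// (lt_trans ltr01).
have [p _] := Qn_point R (ltnW n1); have [q pq] := agree_exactly p 0 n1.
have neq x y i : (forall j, agree_upto x y j <-> j <= i) -> x <> y :> Qn R n.
  move=> h e; have /h : agree_upto x y (i + 1) by rewrite e; exact: agree_refl.
  by lia.
have act_neq g x y : x <> y -> act g x <> act g y.
  by move=> xy /(bij_inj (qs g).1).
have /choice[l hl] : forall g, exists l, forall i, agree_upto (act g p)
  (act g q) i <-> i <= l.
  by move=> g; apply/agree_level/act_neq; exact: neq pq.
have [b hb] := exprz_unbounded K N1; pose k := absz b.
have Kk : K <= n%:R ^ k%:Z.
  by apply: le_trans (ltW hb) _; rewrite ler_weXz2l ?(ltW N1)//; lia.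
have est g x y x' y' a a' e e' : (forall i, agree_upto x y i <-> i <= a) ->
    (forall i, agree_upto x' y' i <-> i <= a') ->
    (forall i, agree_upto (act g x) (act g y) i <-> i <= e) ->
    (forall i, agree_upto (act g x') (act g y') i <-> i <= e') ->
    e' - a' - (e - a) <= k%:Z.
  move=> ha ha' he he'; have xy := neq _ _ _ ha; have xy' := neq _ _ _ ha'.
  have := (qs g).2 _ _ _ _ xy xy'.
  rewrite (mdist_level xy ha) (mdist_level xy' ha').
  rewrite (mdist_level (act_neq g _ _ xy) he) (mdist_level (act_neq g _ _ xy')
    he').
  move=> /le_trans/(_ Kk).
  rewrite !invr_expz -!expfzDr// !invr_expz -!expfzDr// ler_eXz2l//.
  lia.
exists l, k => g x y i; have [->|/eqP xy] := eqVneq x y.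
  by split=> _; exact: agree_refl.
have [a ha] := agree_level xy; have [e he] := agree_level (act_neq g _ _ xy).
have h1 := est g _ _ _ _ _ _ _ _ ha pq he (hl g).
have h2 := est g _ _ _ _ _ _ _ _ pq ha (hl g) he.
by split=> [/ha|/he] h; [apply/he|apply/ha]; lia.
Qed.

(** * From cocompactness to a covering by translates of a cell *)

Lemma nbhs_cell (R : realType) (n : nat) (x : Qn R n) i : (1 < n)%N ->
  nbhs x (cell x i).
Proof.
move=> n1; apply/nbhs_ballP; exists (n%:R ^ (- i)) => /=.
  by rewrite exprz_gt0// ltr0n ltnW.
by move=> y; rewrite ballEmdist /= => /ltW /mdist_agree; exact.
Qed.

(** Near each pair of [C] the three conditions hold for all large [k]; compactness makes [k]
    uniform. *)
Lemma compact_pairs (R : realType) (n : nat) (C : set (Qn R n * Qn R n)) x0 :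
  (1 < n)%N -> compact C -> C `<=` distinct_pairs (Qn R n) ->
  exists k : nat, forall p, C p -> [/\ agree_upto x0 p.1 (- k%:Z),
    agree_upto p.1 p.2 (- k%:Z) & ~ agree_upto p.1 p.2 k%:Z].
Proof.
move=> n1 /compact_near_coveringP cC CD.
pose P (k : nat) (p : Qn R n * Qn R n) := [/\ agree_upto x0 p.1 (- k%:Z),
    agree_upto p.1 p.2 (- k%:Z) & ~ agree_upto p.1 p.2 k%:Z].
have : \forall k \near \oo, C `<=` P k.
  apply: cC => -[x y] /CD xy; have [a ha] := agree_level xy.
  have [b hb] := agree_ex x0 x; pose k := (absz a + absz b + 1)%N.
  exists (cell x k%:Z `*` cell y k%:Z, [set j | (k <= j)%N]) => /=.
    split; last by exists k.
    by exists (cell x k%:Z, cell y k%:Z) => //; split; exact: nbhs_cell.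
  move=> [[x' y'] j] /= [[xx' yy'] kj].
  have le_ u v i : agree_upto u v k%:Z -> i <= k%:Z -> agree_upto u v i.
    by move=> uv ik; exact: agree_le uv.
  have ya : agree_upto x y (- j%:Z) by apply/ha; rewrite /k in kj; lia.
  split=> /=.
  - apply: (agree_trans (y := x)); last by apply: le_ xx' _; lia.
    by apply: agree_le hb; rewrite /k in kj; lia.
  - apply: (agree_trans (y := x)); first by apply: agree_sym; apply: le_ xx' _;
    lia.
    by apply: (agree_trans (y := y)) => //; apply: le_ yy' _; lia.
  move=> x'y'; have /ha : agree_upto x y k%:Z; last by rewrite /k; lia.
  apply: (agree_trans (y := x')) => //; apply: (agree_trans (y := y')).
    by apply: agree_le x'y'; lia.
  exact: agree_sym.
by move=> [k _ /(_ k (leqnn k)) h]; exists k => p /h.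
Qed.

(** A pair [(z, w)] of exact level [i] is the image under some [g] of a pair in [C], whose level
    lies between [-b] and [b]. Hence [l g] differs from [i] by at most [k + b]. *)
Lemma cocompact_cover (R : realType) (n : nat) (G : groupType)
    (act : G -> Qn R n -> Qn R n) l k x0 : (1 < n)%N -> quasilevel act l k ->
  cocompact_on (distinct_pairs (Qn R n)) (pair_action act) ->
  exists (k' : nat) i0, quasilevel act l k' /\ forall z i,
    exists g, set_act act g (cell x0 i0) z /\ `|l g - i| <= k'%:Z.
Proof.
move=> n1 lP [C [cC CD DC]]; have [b hb] := compact_pairs x0 n1 cC CD.
exists (k + b)%N, (- b%:Z); split=> [g x y i|z i].
  by split=> xy; [have [+ _] := lP g x y i|have [_ +] := lP g x y i];
    move=> /(_ xy); apply: agree_le; lia.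
have [w zw] := agree_exactly z i n1.
have dzw : distinct_pairs (Qn R n) (z, w).
  move=> /= e; have /zw : agree_upto z w (i + 1) by rewrite e;
    exact: agree_refl.
  by lia.
have [g _ [p Cp [e1 e2]]] := DC _ dzw; have [h1 h2 h3] := hb p Cp.
exists g; split; first by rewrite -e1; exists p.1.
have /zw hi : agree_upto z w (- b%:Z + l g - k%:Z).
  by rewrite -e1 -e2; have [+ _] := lP g p.1 p.2 (- b%:Z); exact.
have hj : agree_upto p.1 p.2 (i - l g - k%:Z).
  by have [_ +] := lP g p.1 p.2 i; apply; rewrite e1 e2; exact/zw.
have : i - l g - k%:Z < b%:Z.
  by rewrite ltNge; apply/negP => bi; apply: h3; exact: agree_le hj.
lia.
Qed.

(** * Identification with Q_m and the conjugated action *)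

Lemma equivariant_tree (R : realType) (n : nat) (G : groupType)
    (act : G -> Qn R n -> Qn R n) l (k : nat) x0 i0 :
  (1 < n)%N -> group_action act -> quasilevel act l k ->
  (forall z i, exists g, set_act act g (cell x0 i0) z /\ `|l g - i| <= k%:Z) ->
  exists (m : nat) (f : Qn R n -> Qn R m) (c : R),
    [/\ (1 < m)%N, bijective f, 0 < c,
    forall x y i, (agree_upto (f x) (f y) i -> mdist x y <= c * m%:R ^ (- i)) /\
      (mdist x y <= c^-1 * m%:R ^ (- i) -> agree_upto (f x) (f y) i) &
    forall g, exists e, forall x y i,
      agree_upto (f x) (f y) i <->
      agree_upto (f (act g x)) (f (act g y)) (i + e)].
Proof.
move=> n1 actP lP cov.
have [c [c0 hc]] := agree_qnear n1 actP lP cov.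
have [lam [lam1 hlam lam_min]] := scale_step n1 actP lP cov c0 hc.
pose br := ncard_children n1 actP lP cov c0 hc lam1 hlam lam_min.
(* The ratio [lam] is an integer, being a number of children. *)
pose m := ncard (children (act := act) (x0 := x0) (i0 := i0) c lam 0 x0).
have mlam : m%:R = lam := (br 0 x0).2.
have m1 : (1 < m)%N by rewrite -(ltr1n R) mlam.
pose rho := c * n%:R ^ (- i0).
have rho0 : 0 < rho by rewrite mulr_gt0// exprz_gt0// N_gt0.
pose eqv i := qnear (act := act) (x0 := x0) (i0 := i0) (rho * m%:R ^ (- i)).
have M0 : 0 < m%:R :> R by rewrite ltr0n ltnW.
(* The summand [rho] serves [eqv_mdist] and the summand [c / rho] serves [mdist_eqv]. *)
pose c' := rho + c / rho; have c'0 : 0 < c' by rewrite addr_gt0// divr_gt0.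
have eqv_refl i x : eqv i x x.
  by apply: (qnear_refl n1 actP lP); rewrite mulr_ge0// ?ltW// exprz_gt0.
have eqv_sym i x y : eqv i x y -> eqv i y x by exact: qnear_sym.
have eqv_trans i y x z : eqv i x y -> eqv i y z -> eqv i x z.
  exact: (qnear_trans n1).
have eqv_le i j x y : j <= i -> eqv i x y -> eqv j x y.
  move=> ji; apply: (qnear_le n1 actP lP); rewrite ler_pM2l//.
  by rewrite ler_weXz2l ?ler1n ?(ltnW m1)// lerN2.
have eqv_mdist i x y : eqv i x y -> mdist x y <= c' * m%:R ^ (- i).
  move=> /(qnear_mdist n1 actP lP) /le_trans; apply.
  by rewrite ler_pM2r ?exprz_gt0// lerDl ltW// divr_gt0.
have mdist_eqv i x y : mdist x y <= c'^-1 * m%:R ^ (- i) -> eqv i x y.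
  have [->|/eqP xy] := eqVneq x y; first by move=> _; exact: eqv_refl.
  have [a ha] := agree_level xy; rewrite (mdist_level xy ha) => ai.
  have /ha/hc : a <= a by []; apply: (qnear_le n1 actP lP).
  rewrite -ler_pdivlMl//; apply: (le_trans ai); rewrite mulrA.
  rewrite ler_pM2r ?exprz_gt0// ler_pdivlMl// ler_pdivrMr//.
  by rewrite mulrDr [rho * (c / rho)]mulrC divfK ?gt_eqF// lerDr mulr_ge0// ltW.
have branching j x : finite_set (subcls eqv j (cls eqv (j - 1) x)) /\
    ncard (subcls eqv j (cls eqv (j - 1) x)) = m.
  (* Levels run against radii: level [j - 1] has radius exponent [1 - j]. *)
  have -> : subcls eqv j (cls eqv (j - 1) x) =
      children (act := act) (x0 := x0) (i0 := i0) c lam (1 - j) x.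
    rewrite /subcls /children /cls /eqv mlam /nball -/rho.
    by have -> : 1 - j - 1 = - j by [lia]; have -> : 1 - j = - (j - 1) by lia.
  have [fin cm] := br (1 - j) x; split=> //.
  by apply/eqP; rewrite -(eqr_nat R) cm mlam.
have [f [bf fP]] := coordinates_ex n1 m1 x0 eqv_refl eqv_sym eqv_trans eqv_le
  c'0 eqv_mdist mdist_eqv branching.
exists m, f, c'; split=> // [x y i|g].
  by split=> [/fP|/mdist_eqv] h; [exact: eqv_mdist|exact/fP].
have [j gj] := Delta_power n1 actP lP cov c0 hc lam1 hlam lam_min g.
exists (- j) => x y i; rewrite !fP /eqv -(qnear_act n1 actP lP g) gj -mlam.
rewrite -mulrA -expfzDr ?gt_eqF//.
by have -> : - i + j = - (i + - j) by lia.
Qed.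

Theorem theorem7 (R : realType) (n : nat) (hn : (2 <= n)%N) (G : groupType)
    (act : G -> Qn R n -> Qn R n)
    (hqs : uniform_quasisimilarity_action act)
    (hcoc : cocompact_on (distinct_pairs (Qn R n)) (pair_action act)) :
  exists (m : nat) (f : Qn R n -> Qn R m) (act' : G -> Qn R m -> Qn R m),
    [/\ (2 <= m)%N, bilipschitz f, similarity_action act' & conjugates f act act'].
Proof.
case: hqs => actP [K [_ /(quasisimilarity_level hn)[l [k lP]]]].
have [x0 _] := Qn_point R (ltnW hn).
have [k' [i0 [lP' cov]]] := cocompact_cover x0 hn lP hcoc.
have [m [f [c [m1 bf c0 fd fact]]]] := equivariant_tree hn actP lP' cov.
have [f' fK f'K] := bf.
have M0 : 0 < m%:R :> R by rewrite ltr0n ltnW.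
exists m, f, (fun g u => f (act g (f' u))); split=> //.
(* The map contracts by at most [c] and expands by at most [c m], the factor [m] coming from the
   first level [a + 1] of disagreement; the last term ensures that the constant is at least 1. *)
- split=> //; exists (c * m%:R + c + 1).
  have cm0 : 0 <= c * m%:R by rewrite mulr_ge0// ltW.
  have K1 : 1 <= c * m%:R + c + 1 by lra.
  have K0 := lt_le_trans ltr01 K1.
  split=> // x y; have [->|/eqP xy] := eqVneq x y; first
    by rewrite !mdistxx !mulr0 lexx.
  have fxy : f x <> f y by move=> /(can_inj fK).
  have [a ha] := agree_level fxy; rewrite (mdist_level fxy ha).
  have D0 : 0 < m%:R ^ (- a) :> R by rewrite exprz_gt0.
  apply/andP; split.
    rewrite ler_pdivrMl//; apply: le_trans ((fd x y a).1 _) _; first exact/ha.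
    by rewrite ler_pM2r//; lra.
  have : ~ (mdist x y <= c^-1 * m%:R ^ (- (a + 1))).
    by move=> /(fd x y (a + 1)).2 /ha; lia.
  move=> /negP; rewrite -ltNge => /ltW.
  rewrite opprD expfzDr ?gt_eqF// exprN1 mulrA mulrAC -invfM.
  rewrite ler_pdivrMl ?mulr_gt0// => /le_trans; apply.
  by apply: ler_wpM2r; [exact: mdist_ge0|lra].
- split; first split=> [u|g h u].
  + by rewrite actP.1 f'K.
  + by rewrite actP.2 fK.
  move=> g; split.
    exists (fun u => f (act g^-1%g (f' u))) => u.
      by rewrite fK (actK actP) f'K.
    by rewrite fK (actVK actP) f'K.
  have [e he] := fact g; exists (m%:R ^ (- e)) => u v uv.
  have fuv : f (act g (f' u)) <> f (act g (f' v)).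
    by move=> /(can_inj fK) /(act_inj actP) /(can_inj f'K).
  have [a ha] := agree_level uv; have [b hb] := agree_level fuv.
  rewrite (mdist_level uv ha) (mdist_level fuv hb).
  have ab i : i <= a <-> i + e <= b.
    by rewrite -ha -hb -he !f'K.
  have -> : b = a + e by apply/le_anti; have := (ab a).1; have :=
    (ab (b - e)).2; lia.
  rewrite opprD expfzDr ?gt_eqF// mulrAC divff ?mul1r// expfz_neq0// gt_eqF//.
- by move=> g x; rewrite fK.
Qed.
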